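(* Let $F\subset\mathbb R^3$ be an irreducible algebraic surface and let $G=\alpha(F^\star)$. Then the offset surfaces $F_d$ of $F$ are birationally equivalent to the conchoid surfaces $G_d$ of $G$.
   Context: $F^\star$ denotes the dual surface of $F$, i.e. the set of tangent planes of $F$. These are written $E:\ \mathbf n\cdot\mathbf x=e$ with $\mathbf n$ a unit normal vector field of $F$ and $e=\mathbf f\cdot\mathbf n$ for the point of contact $\mathbf f$. The (one-sided) offset surface $F_d$ of $F$ at oriented distance $d\in\mathbb R$ has points $\mathbf f+d\,\mathbf n$; it is the envelope of the planes $\mathbf n\cdot\mathbf x=e+d$. The foot-point map $\alpha$ with respect to the origin $O$ sends a plane $\{\mathbf x:\mathbf x\cdot\mathbf n=e\}$ to the point $\frac{e}{\|\mathbf n\|^2}\mathbf n$; it is a birational map from the space of planes to the space of points. In homogeneous coordinates it sends the plane $u_0x_0+u_1x_1+u_2x_2+u_3x_3=0$ to the point $(-(u_1^2+u_2^2+u_3^2):u_0u_1:u_0u_2:u_0u_3)$. For a surface $G$ with polar representation $\mathbf g=r\,\mathbf s$, $\|\mathbf s\|=1$, the (one-sided) conchoid surface $G_d$ of $G$ with respect to $O$ at distance $d$ has points $(r+d)\,\mathbf s$. Here $G=\alpha(F^\star)$ has the polar representation with spherical part $\mathbf s=\mathbf n$ and radius function $r=e$.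
   Formalization: It is assumed that G (equivalently F* ) and the offset F_d are irreducible surfaces; without this the claim fails for planes and cylinders (G_d is at most a curve) and for a sphere of radius r not centred at O with d = -r (F_d is a point). *)

(* Defs.v *)
From HB Require Import structures.
From mathcomp Require Import all_boot all_order all_algebra.
From mathcomp Require Import boolp classical_sets reals.
From mathcomp Require Import mpoly.

Set Implicit Arguments.
Unset Strict Implicit.
Unset Printing Implicit Defensive.

Import Order.TTheory GRing.Theory Num.Theory.
Local Open Scope classical_set_scope.
Local Open Scope ring_scope.

Section AffineVarieties.
Context {R : realType} {k : nat}.
Implicit Types (A B S : set 'rV[R]_k) (p : {mpoly R[k]}) (x : 'rV[R]_k).

Definition vanishing_ideal S : set {mpoly R[k]} :=
  [set p | forall x, S x -> p.@[x 0] = 0].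

Definition zero_locus (I : set {mpoly R[k]}) : set 'rV[R]_k :=
  [set x | forall p, I p -> p.@[x 0] = 0].

Definition zclosure S : set 'rV[R]_k := zero_locus (vanishing_ideal S).

Definition zclosed S : Prop := zclosure S = S.

Definition zdense_in S A : Prop := S `<=` A /\ A `<=` zclosure S.

Definition zirreducible S : Prop :=
  S !=set0 /\
  forall A B, zclosed A -> zclosed B -> S `<=` A `|` B -> S `<=` A \/ S `<=` B.

Definition irreducible_mpoly p : Prop :=
  [/\ p != 0, p \isn't a GRing.unit &
      forall q r, p = q * r -> q \is a GRing.unit \/ r \is a GRing.unit].

(* Over the reals, the zero locus of an irreducible polynomial may be empty or
   of codimension at least 2 (e.g. 'X_0 ^+ 2 + 'X_1 ^+ 2).  That p generates
   the vanishing ideal says precisely that the locus has codimension 1. *)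
Definition irreducible_hypersurface A : Prop :=
  exists p, [/\ irreducible_mpoly p, A = zero_locus [set p] &
                vanishing_ideal A = [set q | exists r, q = r * p]].

Definition grad p x : 'rV[R]_k := \row_i (p^`M(i)).@[x 0].

(* When the vanishing ideal of A is generated by f, these are the nonzero
   multiples of grad f x; there are none at the points where grad f x = 0. *)
Definition normal_at A x (m : 'rV[R]_k) : Prop :=
  [/\ A x, m != 0 & exists2 p, vanishing_ideal A p & m = grad p x].

Definition dot (u v : 'rV[R]_k) : R := \sum_i u 0 i * v 0 i.

End AffineVarieties.

Section Birational.
Context {R : realType} {k l : nat}.

(* A rational map R^k --> R^l, written with a common denominator. *)
Record ratmap : Type := RatMap {
  rnum : 'I_l -> {mpoly R[k]};
  rden : {mpoly R[k]} }.

Definition rdom (f : ratmap) : set 'rV[R]_k :=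
  [set x | (rden f).@[x 0] != 0].

Definition reval (f : ratmap) (x : 'rV[R]_k) : 'rV[R]_l :=
  \row_j ((rnum f j).@[x 0] / (rden f).@[x 0]).

Definition rational_map (X : set 'rV[R]_k) (Y : set 'rV[R]_l) (f : ratmap) :=
  zdense_in (X `&` rdom f) X /\ forall x, X x -> rdom f x -> Y (reval f x).

End Birational.
Arguments ratmap : clear implicits.

Definition rational_retraction {R : realType} {k l : nat} (X : set 'rV[R]_k)
    (f : ratmap R k l) (g : ratmap R l k) : Prop :=
  let D := X `&` rdom f `&` [set x | rdom g (reval f x)] in
  zdense_in D X /\ forall x, D x -> reval g (reval f x) = x.

Definition birational {R : realType} {k l : nat}
    (X : set 'rV[R]_k) (Y : set 'rV[R]_l) : Prop :=
  exists (f : ratmap R k l) (g : ratmap R l k),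
    [/\ rational_map X Y f, rational_map Y X g,
        rational_retraction X f g & rational_retraction Y g f].

Section OffsetsConchoids.
Context {R : realType}.
Local Notation space := ('rV[R]_3).
Implicit Types (F G U : set space) (n s : space -> space) (r : space -> R).

(* The pair E, with E.1 != 0, stands for the plane {y | dot E.1 y = E.2};
   proportional pairs stand for the same plane, and dual_surface F contains all
   the pairs standing for a given tangent plane of F. *)
Definition dual_surface F : set (space * R) :=
  [set E | exists x, normal_at F x E.1 /\ E.2 = dot E.1 x].

Definition foot_point (E : space * R) : space :=
  (E.2 / dot E.1 E.1) *: E.1.

Definition foot_point_surface F : set space :=
  zclosure (foot_point @` dual_surface F).

(* The field is defined on a Zariski-dense set U of regular points of F.  The
   irreducibility of its graph forbids jumps between algebraic branches: if
   the two unit normals at the points of F form two algebraic components, as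
   for a sphere, then n stays in one of them (inward or outward).  If they form
   only one component, any choice of signs is allowed, and the Zariski closure
   of the points x + d *: n x does not depend on it. *)
Definition unit_normal_field F U n : Prop :=
  [/\ zdense_in U F,
      forall x, U x -> normal_at F x (n x) /\ dot (n x) (n x) = 1 &
      zirreducible [set row_mx x (n x) | x in U]].

Definition offset U n (d : R) : set space :=
  zclosure [set x + d *: n x | x in U].

(* r and s are the radius function and the spherical part of G, both
   parametrized by U. *)
Definition polar_representation G U r s : Prop :=
  (forall x, U x -> dot (s x) (s x) = 1) /\
  G = zclosure [set r x *: s x | x in U].

Definition conchoid U r s (d : R) : set space :=
  zclosure [set (r x + d) *: s x | x in U].

End OffsetsConchoids.

(* Main.v *)
Require Import Defs.
From HB Require Import structures.
From mathcomp Require Import all_boot all_order all_algebra.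
From mathcomp Require Import boolp classical_sets reals.
From mathcomp Require Import mpoly ring lra zify.

(* The foot-point map turns an offset into a conchoid, so the point is that a
   point y = x + d n of F_d and its image z = (n . y) n in G_d determine each
   other rationally.  Both y and z are polynomial in the points (x, n) of the
   graph of the unit normal field; let K be the function field of this graph.
   Every derivation D of K over R satisfies n . Dy = 0 and (2 z - y) . Dz = 0.
   If a and b are relations of least degree satisfied by y and by z, then also
   grad a(y) . Dy = 0 and grad b(z) . Dz = 0.  Since F_d and G are surfaces, the
   vectors Dy, and likewise the vectors Dz, span a plane over K; hence grad a(y)
   is parallel to n, and grad b(z) to 2 z - y.  So the direction of n, and with
   it z, is rational in y, and y is rational in z because z . y = z . z.

   That the Dy span a plane is the Jacobian criterion: a derivation that kills
   the coordinates of a surface vanishes, because any three elements of K are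
   algebraically dependent, which is proved by counting monomials.  Elements of
   K are represented by polynomials in (x, n), modulo those vanishing on the
   graph. *)

Set Implicit Arguments.
Unset Strict Implicit.
Unset Printing Implicit Defensive.

Import Order.TTheory GRing.Theory Num.Theory.
Local Open Scope classical_set_scope.
Local Open Scope ring_scope.

(** * Polynomial vector fields *)

Section Mpoly.
Context {R : comNzRingType}.

Lemma mpoly_alg_ind {k : nat} (P : {mpoly R[k]} -> Prop) :
  (forall c, P c%:MP) -> (forall i, P 'X_i) ->
  (forall p q, P p -> P q -> P (p + q)) ->
  (forall p q, P p -> P q -> P (p * q)) -> forall p, P p.
Proof.
move=> PC PX PD PM; elim/mpolyind => [|c m p _ _ Pp]; first by rewrite -mpolyC0.
apply: (PD) => //; rewrite -mul_mpolyC; apply: (PM) => //.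
rewrite mpolyXE_id; apply: (big_ind P) => [|q r|i _]; last 1 first.
- elim: (m i) => [|e IHe]; first by rewrite expr0 -mpolyC1.
  by rewrite exprS; apply: (PM).
- by rewrite -mpolyC1.
exact: PM.
Qed.

Lemma mderivXU {k : nat} (i j : 'I_k) :
  ('X_i : {mpoly R[k]})^`M(j) = (i == j)%:R.
Proof.
rewrite mderivX mnm1E; case: eqP => [<-|_]; last by rewrite scale0r.
by rewrite -{1}[U_(i)%MM]add0m addmK mpolyX0 scale1r.
Qed.

Definition poly_map {k l : nat} (w : 'I_l -> {mpoly R[k]}) (x : 'rV[R]_k) :
  'rV[R]_l := \row_i (w i).@[x 0].

Lemma meval_comp {k l : nat} (w : 'I_l -> {mpoly R[k]}) p (x : 'rV[R]_k) :
  (p \mPo mktuple w).@[x 0] = p.@[poly_map w x 0].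
Proof.
by rewrite comp_mpoly_meval; apply: meval_eq => i; rewrite tnth_mktuple mxE.
Qed.

Lemma meval_sum {k : nat} (I : Type) (r : seq I) (P : pred I)
    (F : I -> {mpoly R[k]}) (v : 'I_k -> R) :
  (\sum_(i <- r | P i) F i).@[v] = \sum_(i <- r | P i) (F i).@[v].
Proof. exact: (raddf_sum (meval v)). Qed.

Definition vfield {k : nat} (V : 'I_k -> {mpoly R[k]}) (q : {mpoly R[k]}) :=
  \sum_i V i * q^`M(i).

Section Vfield.
Context {k : nat} (V : 'I_k -> {mpoly R[k]}).
Local Notation D := (vfield V).

Lemma vfieldC c : D c%:MP = 0.
Proof. by rewrite /vfield big1 // => i _; rewrite mderivC mulr0. Qed.

Lemma vfieldD p q : D (p + q) = D p + D q.
Proof.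
by rewrite /vfield -big_split /=; apply: eq_bigr => i _; rewrite mderivD mulrDr.
Qed.

Lemma vfieldM p q : D (p * q) = D p * q + p * D q.
Proof.
rewrite /vfield mulr_suml mulr_sumr -big_split /=.
by apply: eq_bigr => i _; rewrite mderivM; ring.
Qed.

Lemma vfieldB p q : D (p - q) = D p - D q.
Proof.
by rewrite -[q in LHS]mul1r -mulNr -mpolyC1 -mpolyCN vfieldD vfieldM vfieldC
  mul0r add0r mpolyCN mpolyC1 mulN1r.
Qed.

Lemma vfield_sum (I : Type) (r : seq I) (P : pred I) (F : I -> {mpoly R[k]}) :
  D (\sum_(i <- r | P i) F i) = \sum_(i <- r | P i) D (F i).
Proof.
apply: (big_morph D vfieldD).
by rewrite -mpolyC0 vfieldC mpolyC0.
Qed.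

Lemma vfieldX i : D 'X_i = V i.
Proof.
rewrite /vfield (bigD1 i) //= big1 => [|j /negbTE ji]; rewrite mderivXU.
  by rewrite eqxx mulr1 addr0.
by rewrite eq_sym ji mulr0.
Qed.

Lemma vfield_comp {l : nat} (w : 'I_l -> {mpoly R[k]}) p :
  D (p \mPo mktuple w) = \sum_i (p^`M(i) \mPo mktuple w) * D (w i).
Proof.
move: p; apply: mpoly_alg_ind => [c|j|p q IHp IHq|p q IHp IHq].
- rewrite comp_mpolyC vfieldC big1 // => i _.
  by rewrite mderivC comp_mpoly0 mul0r.
- rewrite comp_mpolyXU -tnth_nth tnth_mktuple.
  rewrite (bigD1 j) //= big1 => [|i /negbTE ji]; rewrite mderivXU.
    by rewrite eqxx comp_mpoly1 mul1r addr0.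
  by rewrite eq_sym ji comp_mpoly0 mul0r.
- rewrite comp_mpolyD vfieldD IHp IHq -big_split /=.
  by apply: eq_bigr => i _; rewrite mderivD comp_mpolyD mulrDl.
rewrite rmorphM /= vfieldM IHp IHq mulr_suml mulr_sumr -big_split /=.
by apply: eq_bigr => i _; rewrite mderivM comp_mpolyD !rmorphM /=; ring.
Qed.

End Vfield.
End Mpoly.

(** * Zariski-dense parametrizations *)

Section Zariski.
Context {R : realType}.

Section Closure.
Context {k : nat}.
Implicit Types (S A : set 'rV[R]_k) (p q : {mpoly R[k]}).

Lemma sub_zclosure S : S `<=` zclosure S.
Proof. by move=> x Sx p; apply. Qed.

Lemma vanishing_ideal_zclosure S :
  vanishing_ideal (zclosure S) = vanishing_ideal S.
Proof.
apply/seteqP; split=> p pS x Sx; first exact/pS/sub_zclosure.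
exact: Sx.
Qed.

Lemma vanishing_ideal_zdense S A p :
  zdense_in S A -> vanishing_ideal S p -> vanishing_ideal A p.
Proof. by case=> _ AS pS x /AS; rewrite /zclosure; apply. Qed.

Lemma zclosed_zero_locus (I : set {mpoly R[k]}) : zclosed (zero_locus I).
Proof.
apply/seteqP; split; last exact: sub_zclosure.
by move=> x Ix p Ip; apply: Ix => y; apply.
Qed.

Lemma vanishing_ideal_prime S p q : zirreducible S ->
  vanishing_ideal S (p * q) -> vanishing_ideal S p \/ vanishing_ideal S q.
Proof.
case=> _ irrS pqS.
have := irrS _ _ (zclosed_zero_locus [set p]) (zclosed_zero_locus [set q]).
case=> [x Sx|pS|qS].
- have /eqP := pqS _ Sx; rewrite mevalM mulf_eq0 => /orP[]/eqP ?; [left|right];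
    by move=> _ ->.
- by left=> x /pS; apply.
- by right=> x /qS; apply.
Qed.

End Closure.

(** Turns an identity between rational functions into one between polynomials, to which vanishing
    ideals apply. *)
Lemma clear_denominators {k l : nat} (f : ratmap R k l) p :
  exists P N, forall x, rdom f x ->
    P.@[x 0] = (rden f).@[x 0] ^+ N * p.@[reval f x 0].
Proof.
move: p; apply: mpoly_alg_ind => [c|j|p q|p q].
- by exists c%:MP, 0 => x _; rewrite !mevalC expr0 mul1r.
- exists (rnum f j), 1 => x fx;
    rewrite mevalXU mxE expr1 mulrCA divff ?mulr1 //.
- case=> P [N PN] [Q [M QM]].
  exists (P * rden f ^+ M + Q * rden f ^+ N), (N + M)%N => x fx.
  by rewrite !mevalD !mevalM !rmorphXn /= PN // QM // exprD; ring.
- case=> P [N PN] [Q [M QM]].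
  exists (P * Q), (N + M)%N => x fx.
  by rewrite !mevalM PN // QM // exprD; ring.
Qed.

Lemma rational_map_zclosure {k l : nat} (f : ratmap R k l) S T :
  (forall x, S x -> rdom f x -> T (reval f x)) ->
  forall x, zclosure S x -> rdom f x -> zclosure T (reval f x).
Proof.
move=> fST x Sx fx p pT; have [P [N PN]] := clear_denominators f p.
(* The factor [rden f] makes the product vanish also at the points of [S] outside the domain of
   [f]. *)
have : vanishing_ideal S (P * rden f).
  move=> y Sy; rewrite mevalM.
  have [->|fy] := eqVneq (rden f).@[y 0] 0; first by rewrite mulr0.
  by rewrite PN // pT ?mulr0 ?mul0r//; apply: fST.
move=> /Sx/eqP; rewrite mevalM PN // -mulrA mulf_eq0 (negbTE (expf_neq0 _ fx))
  /=.
by rewrite mulf_eq0 (negbTE fx) orbF => /eqP.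
Qed.

Section PolynomialImages.
Context {m k : nat} (S : set 'rV[R]_m) (w : 'I_k -> {mpoly R[m]}).
Local Notation A := (zclosure [set poly_map w s | s in S]).

Lemma vanishing_ideal_image p :
  vanishing_ideal A p <-> vanishing_ideal S (p \mPo mktuple w).
Proof.
rewrite vanishing_ideal_zclosure; split=> pS x.
  by move=> Sx; rewrite meval_comp pS //; exists x.
by case=> s Ss <-; rewrite -meval_comp pS.
Qed.

(** If [p] vanishes on [D], then [p * h] vanishes on the whole image, and [h] can be cancelled
    because the ideal of [S] is prime. *)
Lemma zdense_nonvanishing (D : set 'rV[R]_k) h : zirreducible S ->
  ~ vanishing_ideal S (h \mPo mktuple w) ->
  D `<=` A -> (forall x, A x -> h.@[x 0] != 0 -> D x) -> zdense_in D A.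
Proof.
move=> irrS hS DA hD; split=> // x Ax p pD; apply: (Ax).
suff : vanishing_ideal A p by rewrite vanishing_ideal_zclosure.
have : vanishing_ideal A (p * h).
  move=> y Ay; rewrite mevalM.
  have [->|hy] := eqVneq h.@[y 0] 0; first by rewrite mulr0.
  by rewrite pD ?mul0r//; apply: hD.
rewrite vanishing_ideal_image rmorphM /= => /(vanishing_ideal_prime irrS)[|//].
by rewrite -vanishing_ideal_image.
Qed.

End PolynomialImages.

Section Birational.
Context {m k l : nat} (S : set 'rV[R]_m).
Context (w : 'I_k -> {mpoly R[m]}) (v : 'I_l -> {mpoly R[m]}).
Context (f : ratmap R k l) (g : ratmap R l k).
Local Notation A := (zclosure [set poly_map w s | s in S]).
Local Notation B := (zclosure [set poly_map v s | s in S]).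
Hypothesis irrS : zirreducible S.
Hypothesis f0 : ~ vanishing_ideal S (rden f \mPo mktuple w).
Hypothesis g0 : ~ vanishing_ideal S (rden g \mPo mktuple v).
Hypothesis fE : forall s, S s ->
  rdom f (poly_map w s) -> reval f (poly_map w s) = poly_map v s.
Hypothesis gE : forall s, S s ->
  rdom g (poly_map v s) -> reval g (poly_map v s) = poly_map w s.

Lemma rational_map_image : rational_map A B f.
Proof.
split.
  by apply: (zdense_nonvanishing (h := rden f)) => // x [].
by apply: rational_map_zclosure => _ [s Ss <-] fs; exists s; rewrite ?fE.
Qed.

Lemma rational_retraction_image : rational_retraction A f g.
Proof.
have [Q [N QN]] := clear_denominators f (rden g).
split=> [|x [[Ax fx] gfx]].
  apply: (zdense_nonvanishing (h := rden f * Q)) => //.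
  - rewrite rmorphM /= => /(vanishing_ideal_prime irrS)[//|QS].
    have : vanishing_ideal S ((rden f \mPo mktuple w) * (rden g \mPo mktuple
      v)).
      move=> s Ss; rewrite mevalM !meval_comp.
      have [->|fs] := eqVneq (rden f).@[poly_map w s 0] 0;
        first by rewrite mul0r.
      have /eqP := QS _ Ss; rewrite meval_comp QN // fE //.
      by rewrite mulf_eq0 (negbTE (expf_neq0 _ fs)) => /eqP ->; rewrite mulr0.
    by move=> /(vanishing_ideal_prime irrS)[].
  - by move=> x [[]].
  - move=> x Ax; rewrite mevalM mulf_eq0 negb_or => /andP[fx].
    by rewrite QN // mulf_eq0 negb_or => /andP[_ gfx]; split.
apply/rowP => j; rewrite mxE.

have [P [M PM]] := clear_denominators f (rnum g j).
(* This is coordinate [j] of [reval g (reval f x) = x] with denominators cleared; the factor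
   [rden f * Q] covers the points where one of the maps is undefined. *)
have : vanishing_ideal [set poly_map w s | s in S]
   (rden f * Q * (P * rden f ^+ N - 'X_j * Q * rden f ^+ M)).
  move=> _ [s Ss <-]; rewrite mevalM mevalM mevalB !mevalM !rmorphXn /=.
  have [->|fs] := eqVneq (rden f).@[poly_map w s 0] 0; first by rewrite !mul0r.
  rewrite PM // QN // fE //.
  have [->|gs] := eqVneq (rden g).@[poly_map v s 0] 0;
    first by rewrite !(mulr0, mul0r).
  have /rowP/(_ j) := gE Ss gs; rewrite mevalXU !mxE => /(canRL (divfK gs)) ->.
  by ring.
move/Ax/eqP; rewrite !mevalM mevalB !mevalM !rmorphXn /= mevalXU PM // QN //.
rewrite !mulf_eq0 (negbTE fx) (negbTE gfx) (negbTE (expf_neq0 _ fx)) /=.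
rewrite (_ : _ - _ = (rden f).@[x 0] ^+ (M + N) *
  ((rnum g j).@[reval f x 0] - x 0 j * (rden g).@[reval f x 0])); last first.
  by rewrite exprD; ring.
rewrite mulf_eq0 (negbTE (expf_neq0 _ fx)) /= subr_eq0 => /eqP ->.
by rewrite mulfK.
Qed.

End Birational.

Lemma birational_images {m k l : nat} (S : set 'rV[R]_m)
    (w : 'I_k -> {mpoly R[m]}) (v : 'I_l -> {mpoly R[m]})
    (f : ratmap R k l) (g : ratmap R l k) :
  zirreducible S ->
  ~ vanishing_ideal S (rden f \mPo mktuple w) ->
  ~ vanishing_ideal S (rden g \mPo mktuple v) ->
  (forall s, S s ->
    rdom f (poly_map w s) -> reval f (poly_map w s) = poly_map v s) ->
  (forall s, S s ->
    rdom g (poly_map v s) -> reval g (poly_map v s) = poly_map w s) ->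
  birational (zclosure [set poly_map w s | s in S])
             (zclosure [set poly_map v s | s in S]).
Proof.
move=> irrS f0 g0 fE gE; exists f, g.
split; [exact: rational_map_image|exact: rational_map_image| |].
  exact: (rational_retraction_image irrS f0 g0 fE gE).
exact: (rational_retraction_image irrS g0 f0 gE fE).
Qed.

End Zariski.

(** * Derivations along the graph of the normals *)

Section NormalGraph.
Context {R : realType}.
Local Notation Q := {mpoly R[3 + 3]}.

(* The variables of Q are the coordinates of a point x, then those of n. *)
Definition base (p : {mpoly R[3]}) : Q :=
  p \mPo [tuple ('X_(lshift 3 i) : Q) | i < 3].

HB.instance Definition _ := GRing.RMorphism.copy base
  (comp_mpoly [tuple ('X_(lshift 3 i) : Q) | i < 3]).

Lemma base_sum (I : Type) (r : seq I) (P : pred I) F :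
  base (\sum_(i <- r | P i) F i) = \sum_(i <- r | P i) base (F i).
Proof. exact: raddf_sum base _ _ _ _. Qed.

Definition normal (i : 'I_3) : Q := 'X_(rshift 3 i).

(** On the graph [grad f] is this multiple of the unit vector n, so this is the signed length of
    [grad f]. *)
Definition slope (f : {mpoly R[3]}) : Q := \sum_i normal i * base f^`M(i).

Definition gradsq (f : {mpoly R[3]}) : {mpoly R[3]} := \sum_i f^`M(i) ^+ 2.

Record normal_graph (f : {mpoly R[3]}) (S : set 'rV[R]_(3 + 3)) : Prop := {
  ng_irr : zirreducible S;
  ng_ideal : forall p, vanishing_ideal S (base p) <-> exists r, p = r * f;
  ng_unit : forall s, S s -> \sum_i (normal i).@[s 0] ^+ 2 = 1;
  ng_grad : forall s i, S s ->
    (base f^`M(i)).@[s 0] = (slope f).@[s 0] * (normal i).@[s 0];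
  ng_slope : forall s, S s -> (slope f).@[s 0] != 0 }.

Definition dgrad (f : {mpoly R[3]}) (tau : 'I_3 -> Q) (i : 'I_3) : Q :=
  \sum_k base f^`M(i)^`M(k) * tau k.

(* Differentiating grad f = (slope f) n and n . n = 1 along the vector
   (slope f) tau gives the derivative of n; the factor slope f keeps the field
   polynomial. *)
Definition tfield (f : {mpoly R[3]}) (tau : 'I_3 -> Q) (i : 'I_(3 + 3)) : Q :=
  match split i with
  | inl j => slope f * tau j
  | inr j => dgrad f tau j - (\sum_k normal k * dgrad f tau k) * normal j
  end.

Definition tder f tau : Q -> Q := vfield (tfield f tau).

Section Theory.
Context (f : {mpoly R[3]}) (S : set 'rV[R]_(3 + 3)) (ngS : normal_graph f S).
Local Notation Z := (vanishing_ideal S).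
Local Notation sig := (slope f).

Lemma Z_prime p q : Z (p * q) -> Z p \/ Z q.
Proof. exact: vanishing_ideal_prime (ng_irr ngS). Qed.

Lemma slope_gradsq s : S s -> (base (gradsq f)).@[s 0] = sig.@[s 0] ^+ 2.
Proof.
move=> Ss; rewrite /gradsq base_sum meval_sum.
under eq_bigr => i _ do
  rewrite !rmorphXn /= (ng_grad ngS) // exprMn.
by rewrite -mulr_sumr (ng_unit ngS) // mulr1.
Qed.

Section Derivation.
Variable tau : 'I_3 -> Q.
Local Notation T := (tder f tau).
Local Notation sh := (dgrad f tau).
Local Notation nsh := (\sum_k normal k * sh k).

Lemma tder_base p : T (base p) = sig * \sum_k base p^`M(k) * tau k.
Proof.
rewrite /T /base vfield_comp mulr_sumr; apply: eq_bigr => k _.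
by rewrite vfieldX /tfield -[lshift 3 k]/(unsplit (inl k)) unsplitK mulrCA.
Qed.

Lemma tder_normal j : T (normal j) = sh j - nsh * normal j.
Proof.
by rewrite /T vfieldX /tfield -[rshift 3 j]/(unsplit (inr j)) unsplitK.
Qed.

(** Only the variation of [grad f] contributes to the derivative of n . grad f, as the derivative of
    n is orthogonal to n. *)
Lemma tder_slope s : S s -> (T sig).@[s 0] = sig.@[s 0] * nsh.@[s 0].
Proof.
move=> Ss; rewrite {1}/slope /tder vfield_sum meval_sum.
under eq_bigr => i _ do
  rewrite vfieldM -/(tder f tau _) -/(tder f tau _) tder_normal tder_base
    -/(sh i) mevalD !mevalM mevalB mevalM (ng_grad ngS) //.
rewrite (eq_bigr (fun i => 2 * sig.@[s 0] * ((normal i).@[s 0] * (sh i).@[s 0])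
   - nsh.@[s 0] * sig.@[s 0] * (normal i).@[s 0] ^+ 2)); last first.
  by move=> i _; ring.
rewrite sumrB -!mulr_sumr (ng_unit ngS) //.
have -> : \sum_i (normal i).@[s 0] * (sh i).@[s 0] = nsh.@[s 0].
  by rewrite meval_sum; apply: eq_bigr => i _; rewrite mevalM.
by ring.
Qed.

Lemma tder_gradsq s : S s ->
  (T (base (gradsq f))).@[s 0] = 2 * sig.@[s 0] ^+ 2 * nsh.@[s 0].
Proof.
move=> Ss; rewrite /gradsq base_sum /tder vfield_sum meval_sum
  [nsh.@[_]]meval_sum.
rewrite mulr_sumr; apply: eq_bigr => i _.
rewrite rmorphXn /= expr2 vfieldM -/(tder f tau _) tder_base -/(sh i).
rewrite mevalD !mevalM (ng_grad ngS) //.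
by ring.
Qed.

(** Equality to first order along [T]. Until [T] is known to preserve the vanishing ideal, congruent
    polynomials need not have congruent derivatives, so both congruences are carried along. *)
Definition tcong p q := Z (p - q) /\ Z (T (p - q)).

Lemma tcong_refl p : tcong p p.
Proof. by rewrite /tcong subrr /tder -mpolyC0 vfieldC mpolyC0; split=> ? _;
  rewrite meval0. Qed.

Lemma tcongD p q p' q' : tcong p q -> tcong p' q' -> tcong (p + p') (q + q').
Proof.
have E : p + p' - (q + q') = (p - q) + (p' - q') by ring.
case=> h1 h2 [h3 h4]; rewrite /tcong E /tder vfieldD.
by split=> s Ss; rewrite mevalD ?(h1, h2, h3, h4) // addr0.
Qed.

Lemma tcongM p q p' q' : tcong p q -> tcong p' q' -> tcong (p * p') (q * q').
Proof.
have E : p * p' - q * q' = (p - q) * p' + q * (p' - q') by ring.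
case=> h1 h2 [h3 h4]; rewrite /tcong E /tder vfieldD !vfieldM.
split=> s Ss; rewrite ?mevalD !mevalM; last rewrite -!/(tder f tau _).
  by rewrite h1 // h3 // mul0r mulr0 addr0.
by rewrite h1 // h2 // h3 // h4 // !(mul0r, mulr0) !addr0.
Qed.

Lemma tcong_trans q p r : tcong p q -> tcong q r -> tcong p r.
Proof.
move=> h1 h2; have := tcongD h1 h2; rewrite /tcong.
by have -> : p + q - (q + r) = p - r by ring.
Qed.

Lemma tcong_slopesq : tcong (sig ^+ 2) (base (gradsq f)).
Proof.
split=> s Ss; first by rewrite mevalB slope_gradsq // rmorphXn /= subrr.
rewrite /tder vfieldB expr2 vfieldM -!/(tder f tau _).
by rewrite mevalB mevalD !mevalM tder_slope // tder_gradsq //; ring.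
Qed.

Lemma tcong_normal i :
  tcong (base (gradsq f) * normal i) (sig * base f^`M(i)).
Proof.
split=> s Ss.
  by rewrite mevalB !mevalM slope_gradsq // (ng_grad ngS) //; ring.
rewrite /tder vfieldB !vfieldM -!/(tder f tau _).
rewrite mevalB !mevalD !mevalM tder_slope // tder_gradsq // tder_normal.
rewrite tder_base -/(sh i) mevalB !mevalM slope_gradsq // (ng_grad ngS) //.
by ring.
Qed.

(* n = (slope f) grad f / gradsq f, where (slope f)^2 = gradsq f. *)
Lemma normal_form q : exists N q0 q1,
  tcong (base (gradsq f) ^+ N * q) (base q0 + sig * base q1).
Proof.
move: q; apply: mpoly_alg_ind => [c|i|p q|p q].
- exists 0, c%:MP, 0; rewrite expr0 mul1r rmorph0 mulr0 addr0.
  by rewrite /base comp_mpolyC; apply: tcong_refl.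
- rewrite -(splitK i); case: (split i) => j /=.
    exists 0, 'X_j, 0; rewrite expr0 mul1r rmorph0 mulr0 addr0.
    by rewrite /base comp_mpolyXU -tnth_nth tnth_mktuple; apply: tcong_refl.
  exists 1, 0, (f^`M(j)); rewrite rmorph0 add0r expr1.
  exact: tcong_normal.
- case=> N [p0 [p1 hp]] [M [q0 [q1 hq]]].
  exists (N + M)%N, (p0 * gradsq f ^+ M + q0 * gradsq f ^+ N),
     (p1 * gradsq f ^+ M + q1 * gradsq f ^+ N).
  have := tcongD (tcongM (tcong_refl (base (gradsq f) ^+ M)) hp)
     (tcongM (tcong_refl (base (gradsq f) ^+ N)) hq).
  rewrite !(rmorphD, rmorphXn, rmorphM) /= exprD; congr tcong; ring.
- case=> N [p0 [p1 hp]] [M [q0 [q1 hq]]].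
  exists (N + M)%N, (p0 * q0 + gradsq f * (p1 * q1)), (p0 * q1 + p1 * q0).
  have E := tcongD (tcong_refl (base p0 * base q0 + sig * (base p0 * base q1 +
    base p1 * base q0)))
    (tcongM tcong_slopesq (tcong_refl (base p1 * base q1))).
  apply: (@tcong_trans ((base p0 + sig * base p1) * (base q0 + sig * base q1))).
    by have := tcongM hp hq; rewrite exprD; congr tcong; ring.
  by move: E; rewrite !(rmorphD, rmorphM) /=; congr tcong; ring.
Qed.

Hypothesis tau_tangent : Z (\sum_k base f^`M(k) * tau k).

Lemma tder_base_vanishing p : Z (base p) -> Z (T (base p)).
Proof.
move/(ng_ideal ngS) => [r ->] s Ss.
have fs : (base f).@[s 0] = 0.
  have /(ng_ideal ngS) : exists r, f = r * f by exists 1; rewrite mul1r.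
  exact.
rewrite tder_base.
rewrite mevalM.
suff -> : (\sum_k base (r * f)^`M(k) * tau k).@[s 0] =
    (base r * \sum_k base f^`M(k) * tau k).@[s 0].
  by rewrite mevalM tau_tangent // !mulr0.
rewrite mulr_sumr [LHS]meval_sum [RHS]meval_sum; apply: eq_bigr => k _.
rewrite mderivM !(rmorphD, rmorphM) /=.
by rewrite fs; ring.
Qed.

(* If u = q0 + sig q1 vanishes on S, then so does its norm q0^2 - sig^2 q1^2,
   which is a multiple of f; hence T u (q0 - sig q1) vanishes too. *)
Lemma tder_vanishing q : Z q -> Z (T q).
Proof.
move=> Zq; have [N [q0 [q1 [h1 h2]]]] := normal_form q.
set u := base q0 + sig * base q1 in h1 h2.
pose v := base q0 - sig * base q1.
have Zu : Z u.
  by move=> s Ss; have := h1 s Ss;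
    rewrite mevalB mevalM (Zq s Ss) mulr0 sub0r => /eqP;
      rewrite oppr_eq0 => /eqP.
have ZTB p : Z (base p) -> Z (T (base p)) := @tder_base_vanishing p.
have Z0 p : Z (sig * p) -> Z p.
  move=> /Z_prime [sig0|//] s Ss.
  by have := ng_slope ngS Ss; rewrite sig0 ?eqxx.
have ZTu : Z (T u).
  have : Z (T u * v).
    have uv : tcong (u * v) (base (q0 ^+ 2 - gradsq f * q1 ^+ 2)).
      have := tcongD (tcong_refl (base q0 ^+ 2)) (tcongM tcong_slopesq
        (tcong_refl (- base q1 ^+ 2))).
      rewrite rmorphB !(rmorphXn, rmorphM) /=; congr tcong; rewrite /u /v; ring.
    have Zb : Z (base (q0 ^+ 2 - gradsq f * q1 ^+ 2)).
      move=> s Ss; have := uv.1 s Ss;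
        rewrite mevalB mevalM Zu // mul0r sub0r => /eqP.
      by rewrite oppr_eq0 => /eqP.
    move=> s Ss; have := uv.2 s Ss;
      rewrite /tder vfieldB vfieldM -!/(tder f tau _).
    rewrite mevalB (ZTB _ Zb) // subr0 mevalD !mevalM => <-.
    by rewrite Zu // mul0r addr0.
  (* If the conjugate [v] vanishes too, then so do [q0] and [q1], and polynomials in x alone are
     already settled. *)
  case/Z_prime => // Zv.
  have Z1 : Z (base q0).
    move=> s Ss; have := Zu s Ss; have := Zv s Ss; rewrite mevalB mevalD; lra.
  have Z2 : Z (base q1).
    by apply: Z0 => s Ss; have := Zu s Ss; rewrite mevalD Z1 // add0r.
  move=> s Ss; rewrite /u /tder vfieldD vfieldM -!/(tder f tau _).
  by rewrite !mevalD !mevalM (ZTB _ Z1) // (ZTB _ Z2) // Z2 // !mulr0 !addr0.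
move=> s Ss; have := h2 s Ss; rewrite /tder vfieldB vfieldM -!/(tder f tau _).
rewrite mevalB (ZTu s Ss) subr0 mevalD !mevalM Zq // mulr0 add0r => /eqP.
rewrite mulf_eq0 rmorphXn /= slope_gradsq // expf_eq0 expf_eq0 (negbTE
  (ng_slope ngS Ss)).
by rewrite !andbF => /eqP.
Qed.

End Derivation.
End Theory.
End NormalGraph.

(** * Algebraic dependence by counting monomials *)

Lemma linear_dependency (K : fieldType) (I J : finType) (phi : I -> J -> K) :
  (#|J| < #|I|)%N ->
  exists c : I -> K, (exists i, c i != 0) /\
    forall j, \sum_i c i * phi i j = 0.
Proof.
move=> JI; pose A := \matrix_(i < #|I|, j < #|J|) phi (enum_val i) (enum_val j).
have /rowV0Pn [v /sub_kermxP vA v0] : kermx A != 0.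
  by rewrite kermx_eq0 /row_free neq_ltn (leq_ltn_trans (rank_leq_col _)).
exists (fun i => v 0 (enum_rank i)); split.
  by have /rV0Pn [i vi] := v0; exists (enum_val i); rewrite enum_valK.
move=> j; transitivity ((v *m A) 0 (enum_rank j)); last by rewrite vA mxE.
rewrite mxE (reindex (@enum_val I I)) /=; last exact: onW_bij (enum_val_bij _).
by apply: eq_bigr => i _; rewrite enum_valK mxE enum_rankK.
Qed.

Section Box.
Context {R : idomainType} {k : nat}.

(** Bounding each exponent, rather than the total degree, gives exactly [N ^ k] monomials. *)
Definition box_mnm {N : nat} (a : {ffun 'I_k -> 'I_N}) : 'X_{1..k} :=
  [multinom (a i : nat) | i < k].

Lemma box_mnm_inj N : injective (@box_mnm N).
Proof.
move=> a b /mnmP ab; apply/ffunP => i; apply: val_inj.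
by have := ab i; rewrite !mnmE.
Qed.

Definition boxed N (p : {mpoly R[k]}) :=
  forall m, m \in msupp p -> forall i, (m i < N)%N.

Lemma boxed_msize N p : (msize p <= N)%N -> boxed N p.
Proof.
move=> pN m /msize_mdeg_lt mp i; apply: leq_trans pN; apply: leq_ltn_trans mp.
by rewrite mdegE (bigD1 i) //= leq_addr.
Qed.

Lemma boxed_monM N L (a : {ffun 'I_k -> 'I_N}) p :
  (msize p <= L)%N -> boxed (N + L) ('X_[box_mnm a] * p).
Proof.
move=> pL m; rewrite mulrC => mp i.
have := msuppM_le mp; rewrite msuppX => /allpairsP [[m1 m2] /= [h1]].
rewrite inE => /eqP -> ->; rewrite mnmDE mnmE addnC.
by have := boxed_msize pL h1 i; have := ltn_ord (a i); lia.
Qed.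

Lemma boxed_eq0 N p : boxed N p ->
  (forall a : {ffun 'I_k -> 'I_N}, p@_(box_mnm a) = 0) -> p = 0.
Proof.
move=> pN p0; apply/mpolyP => m; rewrite mcoeff0.
have [mp|/memN_msupp_eq0 //] := boolP (m \in msupp p).
rewrite -(p0 [ffun i => Ordinal (pN m mp i)]); congr (p@_ _).
by apply/mnmP => i; rewrite mnmE ffunE.
Qed.

Lemma mcoeff_box_sum N (c : {ffun 'I_k -> 'I_N} -> R) a :
  (\sum_b c b *: 'X_[box_mnm b])@_(box_mnm a) = c a.
Proof.
rewrite raddf_sum /= (bigD1 a) //= big1 => [|b ba].
  by rewrite mcoeffZ mcoeffX eqxx mulr1 addr0.
by rewrite mcoeffZ mcoeffX (inj_eq (@box_mnm_inj N)) (negbTE ba) mulr0.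
Qed.

End Box.

(* In degree < L the submodule f R[x] has codimension O(L^2) in R[x], so a large
   enough family of pairs of polynomials has a combination in f R[x] x f R[x].
     *)
Lemma pairs_dependency_mod (R : realType) (I : finType) L (f : {mpoly R[3]})
    (A B : I -> {mpoly R[3]}) : f != 0 ->
  (forall i, msize (A i) <= L)%N -> (forall i, msize (B i) <= L)%N ->
  (2 * (L + msize f) ^ 3 < #|I| + 2 * L ^ 3)%N ->
  exists (c : I -> R) u v, [/\ exists i, c i != 0,
    \sum_i c i *: A i = u * f & \sum_i c i *: B i = v * f].
Proof.
move=> f0 AL BL card; pose E := {ffun 'I_3 -> 'I_L}.
pose mon (b : E) : {mpoly R[3]} := 'X_[box_mnm b] * f.
(* The monomial multiples of [f] are adjoined in each of the two components; a linear relation in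
   this larger family is the wanted combination. *)
pose F (i : I + (E + E)) : {mpoly R[3]} * {mpoly R[3]} :=
  match i with
  | inl i => (A i, B i)
  | inr (inl b) => (mon b, 0)
  | inr (inr b) => (0, mon b)
  end.
have monb b : boxed (L + msize f) (mon b) by exact: boxed_monM.
have lowb (p : {mpoly R[3]}) : (msize p <= L)%N -> boxed (L + msize f) p.
  by move=> pL; apply: boxed_msize; rewrite (leq_trans pL) // leq_addr.
have F1 i : boxed (L + msize f) (F i).1.
  case: i => [i|[b|b]] /=; [exact: lowb|exact: monb|].
  by move=> m; rewrite -mpolyC0 msupp0.
have F2 i : boxed (L + msize f) (F i).2.
  case: i => [i|[b|b]] /=; [exact: lowb| |exact: monb].
  by move=> m; rewrite -mpolyC0 msupp0.
pose J : finType := ({ffun 'I_3 -> 'I_(L + msize f)} + {ffun 'I_3 -> 'I_(L +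
  msize f)})%type.
pose phi i (j : J) := match j with
  | inl a => (F i).1@_(box_mnm a) | inr a => (F i).2@_(box_mnm a) end.
have [|c [[i0 ci0] cphi]] := @linear_dependency _ _ J phi.
  by rewrite !card_sum !card_ffun !card_ord; lia.
have boxed_comb (G : I + (E + E) -> {mpoly R[3]}) :
    (forall i, boxed (L + msize f) (G i)) -> boxed (L + msize f) (\sum_i c i *:
      G i).
  move=> Gb m /msupp_sum_le /flattenP [s /mapP [i _ ->]] /msuppZ_le; exact: Gb.
have S1 : \sum_i c i *: (F i).1 = 0.
  apply: boxed_eq0 (boxed_comb _ F1) _ => a.
  rewrite raddf_sum -[RHS](cphi (inl a)) /=.
  by apply: eq_bigr => i _; rewrite mcoeffZ.
have S2 : \sum_i c i *: (F i).2 = 0.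
  apply: boxed_eq0 (boxed_comb _ F2) _ => a.
  rewrite raddf_sum -[RHS](cphi (inr a)) /=.
  by apply: eq_bigr => i _; rewrite mcoeffZ.
pose u := \sum_b c (inr (inl b)) *: ('X_[box_mnm b] : {mpoly R[3]}).
pose v := \sum_b c (inr (inr b)) *: ('X_[box_mnm b] : {mpoly R[3]}).
move: S1 S2; rewrite !big_sumType /=.
rewrite [X in _ + (_ + X)]big1 => [|b _]; last by rewrite scaler0.
rewrite [X in _ -> _ + (X + _) = 0 -> _]big1 => [|b _]; last by rewrite scaler0.
rewrite addr0 add0r.
have monE (d : E -> R) : \sum_b d b *: mon b = (\sum_b d b *: 'X_[box_mnm b]) *
  f.
  by rewrite mulr_suml; apply: eq_bigr => b _; rewrite scalerAl.
rewrite !monE -/u -/v => /eqP; rewrite addr_eq0 -mulNr => /eqP S1.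
move=> /eqP; rewrite addr_eq0 -mulNr => /eqP S2.
exists (fun i => c (inl i)), (- u), (- v); split=> //.
(* If the relation involved only multiples of [f], then [u] and [v] would be zero because [f] is
   not, and with them all the coefficients. *)
apply: contrapT => /forallNP c0.
have {}c0 i : c (inl i) = 0 by have /negP := c0 i; rewrite negbK => /eqP.
have uv0 w : 0 = - w * f -> w = 0.
  by move/esym/eqP; rewrite mulf_eq0 (negbTE f0) orbF oppr_eq0 => /eqP.
have u0 : u = 0.
  by apply: uv0; rewrite -S1 big1 // => i _; rewrite c0 scale0r.
have v0 : v = 0.
  by apply: uv0; rewrite -S2 big1 // => i _; rewrite c0 scale0r.
case/negP: ci0; case: i0 => [i|[b|b]]; first by rewrite c0.
  by have := mcoeff_box_sum (fun b => c (inr (inl b))) b;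
    rewrite -/u u0 mcoeff0 => <-.
by have := mcoeff_box_sum (fun b => c (inr (inr b))) b;
  rewrite -/v v0 mcoeff0 => <-.
Qed.

(** The difference [2 * ((L + d) ^ 3 - L ^ 3)] is below [14 * d.+1 ^ 3 * L ^ 2], and
    [L <= 4 * D.+1 * N]; hence the constant 224 = 14 * 4 ^ 2. *)
Lemma counting_bound (d D N L : nat) :
  (N = 224 * d.+1 ^ 3 * D.+1 ^ 2 -> L = D * (3 * N) + 1 ->
   2 * (L + d) ^ 3 < N ^ 3 + 2 * L ^ 3)%N.
Proof.
move=> NE LE.
have N0 : (0 < N)%N by rewrite NE; nia.
have LN : (L <= 4 * D.+1 * N)%N by rewrite LE; nia.
have LN2 : (L * L <= (4 * D.+1 * N) * (4 * D.+1 * N))%N by exact: leq_mul.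
have N3 : (N ^ 3 = 14 * d.+1 ^ 3 * ((4 * D.+1 * N) * (4 * D.+1 * N)))%N.
  by rewrite expnS {1}NE; lia.
have LL : (14 * d.+1 ^ 3 * (L * L) <= N ^ 3)%N
  by rewrite N3 leq_mul2l LN2 orbT.
have L1 : (0 < L)%N by rewrite LE addn1.
move: LL L1; clear => h L1.
have : (3 * (L * L) * d + 3 * L * (d * d) + d ^ 3 < 7 * d.+1 ^ 3 * (L * L))%N.
  by nia.
lia.
Qed.

Section Dependency.
Context {R : realType}.
Local Notation Q := {mpoly R[3 + 3]}.
Context (f : {mpoly R[3]}) (S : set 'rV[R]_(3 + 3)) (ngS : normal_graph f S).
Local Notation Z := (vanishing_ideal S).
Local Notation sig := (slope f).

Lemma normal_form_common (w : 'I_3 -> Q) : exists K (a b : 'I_3 -> {mpoly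
  R[3]}),
  forall i s, S s -> ((base (gradsq f ^+ K)) * w i).@[s 0] =
    (base (a i) + sig * base (b i)).@[s 0].
Proof.
have /choice [N /choice [a /choice [b ab]]] i : exists N a b, forall s, S s ->
    (base (gradsq f ^+ N) * w i).@[s 0] = (base a + sig * base b).@[s 0].
  have [N [a [b [ab _]]]] := normal_form ngS (fun=> 0) (w i).
  exists N, a, b => s Ss; apply/eqP; rewrite -subr_eq0 -mevalB rmorphXn /=.
  by apply/eqP; exact: ab.
pose K := \sum_i N i; have KN i : K = (N i + (K - N i))%N.
  by rewrite subnKC // /K (bigD1 i) //= leq_addr.
exists K, (fun i => gradsq f ^+ (K - N i) * a i), (fun i => gradsq f ^+ (K - N
  i) * b i).
move=> i s Ss; rewrite {1}(KN i) exprD !(rmorphM base) /= mulrAC mevalM (ab i s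
  Ss).
rewrite !mevalD !mevalM.
move: (base (a i)).@[_] (base (b i)).@[_] (slope f).@[_] => u v g.
by move: (base _).@[_] => c; ring.
Qed.

(** The [N ^ 3] monomials in [w] with exponents below [N] have, over a common denominator, normal
    forms of size linear in [N]. Modulo [f] such pairs fill a space of dimension quadratic in [N],
    so for large [N] the monomials are linearly dependent on [S]. *)
Lemma algebraic_dependency (w : 'I_3 -> Q) :
  exists2 P : {mpoly R[3]}, P != 0 & Z (P \mPo mktuple w).
Proof.
have [K [a [b ab]]] := normal_form_common w.
(* The products [gradsq f * b i] enter because multiplying two normal forms turns the square of
   [sig] into [gradsq f]. *)
pose D := (\sum_i (msize (a i) + msize (b i) + msize (gradsq f * b i))
  + msize (gradsq f ^+ K))%N.
have Dle i : ([/\ msize (a i) <= D, msize (b i) <= D &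
    msize (gradsq f * b i) <= D])%N.
  by rewrite /D (bigD1 i) //=; split; lia.
have msizeMD (p q : {mpoly R[3]}) s :
    (msize p <= D * s + 1 -> msize q <= D -> msize (p * q) <= D * s.+1 + 1)%N.
  move=> ps qD; have [->|p0] := eqVneq p 0; first by rewrite mul0r msize0.
  have [->|q0] := eqVneq q 0; first by rewrite mulr0 msize0.
  rewrite msizeM // mulnS -addnA; apply: leq_trans (leq_pred _) _.
  by rewrite addnC; apply: leq_add.
have msizeDD (p q : {mpoly R[3]}) s :
    (msize p <= s -> msize q <= s -> msize (p + q) <= s)%N.
  by move=> ps qs; rewrite (leq_trans (msizeD_le _ _)) // geq_max ps.
(* The sizes grow linearly in [s]; the summand 1 is there because [msize] is the degree plus one, so
   that the constant 1 has size 1. *)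
pose good s q := exists A B : {mpoly R[3]},
  [/\ (msize A <= D * s + 1)%N, (msize B <= D * s + 1)%N & forall t, S t ->
   (base (gradsq f ^+ (K * s)) * q).@[t 0] = (base A + sig * base B).@[t 0]].
have good0 : good 0%N 1.
  exists 1, 0; split; first by rewrite -mpolyC1 msizeC oner_neq0 muln0.
    by rewrite -mpolyC0 msizeC eqxx.
  by move=> t _; rewrite muln0 expr0 !rmorph1 rmorph0 mulr0 addr0 mulr1.
have goodw s q i : good s q -> good s.+1 (q * w i).
  have [aD bD gD] := Dle i.
  case=> A [B [AD BD qAB]];
    exists (A * a i + B * (gradsq f * b i)), (A * b i + B * a i).
  split; [by apply: msizeDD; apply: msizeMD|by apply: msizeDD; apply: msizeMD|].
  move=> t St; rewrite mulnS exprD.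
  have -> : base (gradsq f ^+ K * gradsq f ^+ (K * s)) * (q * w i) =
      (base (gradsq f ^+ (K * s)) * q) * (base (gradsq f ^+ K) * w i).
    by rewrite rmorphM /=; ring.
  rewrite mevalM (qAB t St) (ab i t St) !(rmorphD, rmorphM) /=.
  rewrite (slope_gradsq ngS St).
  move: (base A).@[_] (base B).@[_] (base (a i)).@[_] (base (b i)).@[_].
  by move: (slope f).@[_] => g u v u' v'; ring.
(* Padding by powers of [gradsq f] brings monomials of different degrees to the same denominator. *)
have good1 s q : good s q -> good s.+1 q.
  have gD : (msize (gradsq f ^+ K) <= D)%N by rewrite /D leq_addl.
  case=> A [B [AD BD qAB]]; exists (A * gradsq f ^+ K), (B * gradsq f ^+ K).
  split; [exact: msizeMD|exact: msizeMD|].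
  move=> t St; rewrite mulnS exprD.
  have -> : base (gradsq f ^+ K * gradsq f ^+ (K * s)) * q =
      base (gradsq f ^+ K) * (base (gradsq f ^+ (K * s)) * q).
    by rewrite rmorphM /=; ring.
  rewrite mevalM (qAB t St) !(rmorphD, rmorphM) /=.
  move: (base A).@[_] (base B).@[_] (slope f).@[_] => u v g.
  by move: (base _).@[_] => c; ring.
have goodX s q i e : good s q -> good (s + e)%N (q * w i ^+ e).
  move=> sq; elim: e => [|e IHe]; first by rewrite addn0 expr0 mulr1.
  by rewrite addnS exprSr mulrA; apply: goodw.
have good_mon (m : 'X_{1..3}) s : (mdeg m <= s)%N -> good s ('X_[m] \mPo
  mktuple w).
  move=> ms; rewrite -(subnKC ms); elim: (s - mdeg m)%N => [|e IHe]; last first.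
    by rewrite addnS; apply: good1.
  rewrite addn0 comp_mpolyX mdegE;
    under [X in good _ X]eq_bigr do rewrite tnth_mktuple.
  rewrite !big_ord_recr !big_ord0 /=.
  by do 3 apply: (goodX).
pose d := msize f; pose N := (224 * d.+1 ^ 3 * D.+1 ^ 2)%N.
pose L := (D * (3 * N) + 1)%N.
have /choice [A /choice [B AB]] (al : {ffun 'I_3 -> 'I_N}) :
    good (3 * N)%N ('X_[box_mnm al] \mPo mktuple w).
  apply: good_mon; rewrite mdegE !big_ord_recr big_ord0 /= !mnmE.
  have := ltn_ord (al (widen_ord (leqnSn 2) (widen_ord (leqnSn 1) ord_max))).
  have := ltn_ord (al (widen_ord (leqnSn 2) ord_max)).
  have := ltn_ord (al ord_max).
  lia.
have f0 : f != 0.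
  apply/eqP => f0; have [[s Ss] _] := ng_irr ngS.
  have := ng_slope ngS Ss; rewrite /slope f0 big1 ?meval0 ?eqxx// => i _.
  by rewrite mderiv0 rmorph0 mulr0.
have [| | |c [u [v [[al cal] Au Bv]]]] := @pairs_dependency_mod _ _ L f A B f0.
- by move=> al; case: (AB al).
- by move=> al; case: (AB al).
- rewrite card_ffun !card_ord -/d.
  by rewrite (counting_bound (d := d) (D := D)).
exists (\sum_al c al *: 'X_[box_mnm al]).
  apply: contraNneq cal => P0; have := mcoeff_box_sum c al.
  by rewrite P0 mcoeff0 => <-.
move=> s Ss; pose k := (K * (3 * N))%N.
have bf0 : (base f).@[s 0] = 0.
  have /(ng_ideal ngS) : exists r, f = r * f by exists 1; rewrite mul1r.
  exact.
have : (base (gradsq f ^+ k) *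
   ((\sum_al c al *: 'X_[box_mnm al]) \mPo mktuple w)).@[s 0] = 0.
  transitivity ((base (\sum_al c al *: A al) + sig * base (\sum_al c al *: B
    al)).@[s 0]); last first.
    by rewrite Au Bv !rmorphM /= mevalD !mevalM bf0 !mulr0 addr0.
  rewrite raddf_sum !base_sum !mulr_sumr -big_split /= !meval_sum.
  apply: eq_bigr => al' _; have [_ _ /(_ s Ss)] := AB al'.
  rewrite -/k /base !comp_mpolyZ !(mevalD, mevalM, mevalZ) mulrCA => ->.
  move: (_ \mPo _).@[_] (_ \mPo _).@[_] (slope f).@[_] (c al') => p q g r.
  by ring.
move/eqP; rewrite mevalM mulf_eq0 !rmorphXn /= (slope_gradsq ngS Ss).
by rewrite !expf_eq0 (negbTE (ng_slope ngS Ss)) !andbF => /eqP.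
Qed.

End Dependency.

(** * Hypersurfaces and the Jacobian criterion *)

Section Derivatives.
Context {R : realType} {k : nat}.
Implicit Types p : {mpoly R[k]}.

Lemma mderiv_eq0_exponent p i m : p^`M(i) = 0 -> m \in msupp p -> m i = 0%N.
Proof.
move=> pi0; rewrite mcoeff_msupp => pm; case mi: (m i) => [//|e].
have mE : m = (m - U_(i) + U_(i))%MM.
  rewrite submK //; apply/mnm_lepP => j; rewrite mnm1E.
  by case: eqP => // <-; rewrite mi.
have /eqP := mcoeff_mderiv i p (m - U_(i))%MM.
by rewrite pi0 mcoeff0 -mE eq_sym mulrn_eq0 (negbTE pm).
Qed.

Lemma mderiv_eq0_const p : (forall i, p^`M(i) = 0) -> p = (p@_0%MM)%:MP.
Proof.
move=> p0; apply/mpolyP => m; rewrite mcoeffC.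
have [<-|m0] := eqVneq 0%MM m; first by rewrite mulr1.
rewrite mulr0; apply: memN_msupp_eq0; apply/negP => mp.
case/eqP: m0; apply/mnmP => i.
by rewrite mnm0E (mderiv_eq0_exponent (p0 i)).
Qed.

Lemma msize_mderiv p i : p != 0 -> (msize p^`M(i) < msize p)%N.
Proof.
move=> p0; have : (0 < msize p)%N by rewrite lt0n msize_poly_eq0.
case sp: (msize p) => [//|e] _; rewrite ltnS msizeE; apply/bigmax_leqP_seq => m.
rewrite mcoeff_msupp mcoeff_mderiv mulrn_eq0 /= => mp _.
have : (m + U_(i))%MM \in msupp p by rewrite mcoeff_msupp.
by move/msize_mdeg_lt; rewrite sp mdegD mdeg1 addn1.
Qed.

Lemma comp_mderiv_eq0 {l : nat} (v w : 'I_k -> {mpoly R[l]}) p i :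
  p^`M(i) = 0 -> (forall j, j != i -> v j = w j) ->
  p \mPo mktuple v = p \mPo mktuple w.
Proof.
move=> pi0 vw; rewrite !comp_mpolyE; apply: eq_big_seq => m mp.
congr (_ *: _); apply: eq_bigr => j _; rewrite !tnth_mktuple.
have [->|/vw -> //] := eqVneq j i.
by rewrite (mderiv_eq0_exponent pi0 mp) !expr0.
Qed.

End Derivatives.

Section FreeVariable.
Context {R : realType} {m k : nat} (S : set 'rV[R]_m) (w : 'I_k -> {mpoly
  R[m]}).
Local Notation A := (zclosure [set poly_map w s | s in S]).

(* If p does not involve 'X_i and a divides p, where a involves 'X_i, then
   comparing derivatives shows that all the powers of a divide p. *)
Lemma hypersurface_free_variable : zirreducible S -> irreducible_hypersurface A
  ->
  exists i, forall p, p^`M(i) = 0 ->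
    vanishing_ideal S (p \mPo mktuple w) -> p = 0.
Proof.
move=> irrS [a [[a0 aU _] _ IA]].
have IAP p : vanishing_ideal A p <-> exists r, p = r * a by rewrite IA.
(* The ideal of the image is prime because [S] is irreducible, so its generator [a] is a prime
   element. *)
have a_prime p q : (exists r, p * q = r * a) ->
    (exists r, p = r * a) \/ (exists r, q = r * a).
  rewrite -!IAP !vanishing_ideal_image rmorphM /=.
  exact: vanishing_ideal_prime.
have [i ai] : exists i, a^`M(i) != 0.
  apply: contrapT => /forallNP ai; case/negP: aU.
  have aC : a = (a@_0%MM)%:MP.
    by apply: mderiv_eq0_const => i; have /negP := ai i; rewrite negbK => /eqP.
  rewrite aC rmorph_unit // unitfE; apply: contra_neq a0 => a00.
  by rewrite aC a00 mpolyC0.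
have aNi : ~ exists r, a^`M(i) = r * a.
  case=> r ra; have r0 : r != 0.
    by apply: contra_neq ai => r0; rewrite ra r0 mul0r.
  have := msize_mderiv i a0; rewrite ra msizeM //.
  move: r0; rewrite -msize_poly_eq0; case: (msize r) => // n _.
  by rewrite addSn ltnNge leq_addl.
exists i => p pi0; rewrite -vanishing_ideal_image IAP => -[r pr].
suff r0 e : (r * a ^+ e.+1)^`M(i) = 0 -> r = 0.
  by rewrite pr (r0 0%N) ?mul0r // expr1 -pr.
have [n] := ubnP (msize r); elim: n r e {p pi0 pr} => // n IHn r e rn rae.
(* Differentiate [r * a ^+ e.+1] and cancel [a ^+ e]. As [a] is prime and does not divide its
   derivative, it divides [r], and the quotient is smaller than [r]. *)
have ra : (- e.+1%:R *: r) * a^`M(i) = r^`M(i) * a.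
  have mderivX1 (q : {mpoly R[k]}) d : (q ^+ d.+1)^`M(i) = d.+1%:R * q ^+ d *
    q^`M(i).
    elim: d => [|d IHd]; first by rewrite expr1 expr0 mulr1 mul1r.
    by rewrite exprS mderivM IHd exprS -[d.+2%:R]natr1; ring.
  have ae0 : a ^+ e != 0 by rewrite expf_neq0.
  apply: (mulIf ae0); apply/esym/eqP;
    rewrite -subr_eq0 -rae mderivM mderivX1 exprS.
  by rewrite scaleNr scaler_nat -mulr_natl; apply/eqP; ring.
have [|[r' r'E]|//] := a_prime (- e.+1%:R *: r) a^`M(i);
  first by exists r^`M(i).
have {}r'E : r = (- e.+1%:R^-1 *: r') * a.
  rewrite -scalerAl -r'E scalerA mulrNN mulVf ?scale1r //.
  by rewrite pnatr_eq0.
have [r'0|r'0] := eqVneq (- e.+1%:R^-1 *: r') 0; first by rewrite r'E r'0 mul0r.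
suff /eqP : - e.+1%:R^-1 *: r' = 0 by rewrite (negbTE r'0).
apply: (IHn _ e.+1); last by rewrite exprS mulrA -r'E.
move: rn; rewrite {1}r'E msizeM // ltnS => /(leq_trans _); apply.
have a1 : (1 < msize a)%N.
  by apply: leq_ltn_trans (msize_mderiv i a0); rewrite lt0n msize_poly_eq0.
by case: (msize a) a1 => [|[|d]] // _; rewrite addnS /= addnS ltnS leq_addr.
Qed.

End FreeVariable.

(** * Vectors of length three and cross products *)

Lemma ord3_ind (P : 'I_3 -> Prop) : P 0 -> P 1 -> P 2 -> forall i, P i.
Proof.
move=> P0 P1 P2 [[|[|[|//]]] h]; [move: P0|move: P1|move: P2];
  by congr P; apply: val_inj.
Qed.

Lemma sum_ord3 (V : nmodType) (F : 'I_3 -> V) : \sum_i F i = F 0 + F 1 + F 2.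
Proof.
rewrite !big_ord_recr big_ord0 /= add0r.
by congr (F _ + F _ + F _); apply: val_inj.
Qed.

Lemma ord3_add : (((0 + 1)%R = 1 :> 'I_3) * ((1 + 1)%R = 2 :> 'I_3) *
  ((2 + 1)%R = 0 :> 'I_3) * ((0 + 2)%R = 2 :> 'I_3) * ((1 + 2)%R = 0 :> 'I_3) *
  ((2 + 2)%R = 1 :> 'I_3))%type.
Proof. by do !split; apply: val_inj. Qed.

(** Indices are added modulo 3 in ['I_3], so that one formula gives all three coordinates. *)
Definition cross (K : pzRingType) (u v : 'I_3 -> K) (i : 'I_3) : K :=
  u (i + 1) * v (i + 2) - u (i + 2) * v (i + 1).

(** The vector product of [a] with [cross u v] is (a . v) u - (a . u) v, hence zero. *)
Lemma cross_orthogonal (K : comPzRingType) (u v a : 'I_3 -> K) :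
  \sum_i u i * a i = 0 -> \sum_i v i * a i = 0 ->
  forall p q, a p * cross u v q = a q * cross u v p.
Proof.
rewrite !sum_ord3 => ua va.
have next i : a i * cross u v (i + 1) = a (i + 1) * cross u v i.
  apply/eqP; rewrite -subr_eq0; apply/eqP.
  transitivity (u (i + 2) * (v 0 * a 0 + v 1 * a 1 + v 2 * a 2) -
                v (i + 2) * (u 0 * a 0 + u 1 * a 1 + u 2 * a 2)).
    move: i; apply: ord3_ind; rewrite /cross !ord3_add; ring.
  by rewrite ua va !mulr0 subrr.
have := (next 0, next 1, next 2); rewrite !ord3_add => -[[n0 n1] n2].
by apply: ord3_ind; apply: ord3_ind.
Qed.

(** * Rank of parametrizations over the function field *)

Section Rank.
Context {R : realType}.
Local Notation Q := {mpoly R[3 + 3]}.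
Context (f : {mpoly R[3]}) (S : set 'rV[R]_(3 + 3)) (ngS : normal_graph f S).
Local Notation Z := (vanishing_ideal S).
Local Notation sig := (slope f).

Definition tangent (tau : 'I_3 -> Q) := Z (\sum_k base f^`M(k) * tau k).

(** Injectivity of the differential of [w] on tangent fields over K; the tangent plane of F having
    dimension two, this says that [w] has rank two. *)
Definition immersive (w : 'I_3 -> Q) := forall tau, tangent tau ->
  (forall i, Z (tder f tau (w i))) -> forall i, Z (tau i).

(** Descent on the size: a nonzero partial derivative that is itself a relation is a smaller one. *)
Lemma minimal_relation (w : 'I_3 -> Q) : exists P : {mpoly R[3]},
  [/\ P != 0, Z (P \mPo mktuple w) &
      forall i, P^`M(i) != 0 -> ~ Z (P^`M(i) \mPo mktuple w)].
Proof.
have [P P0 ZP] := algebraic_dependency ngS w.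
have [n] := ubnP (msize P); elim: n P P0 ZP => // n IHn P P0 ZP Pn.
have [[i Pi ZPi]|noP] :=
    pselect (exists2 i, P^`M(i) != 0 & Z (P^`M(i) \mPo mktuple w)).
  by apply: (IHn P^`M(i)) => //; rewrite (leq_trans (msize_mderiv i P0)).
by exists P; split=> // i Pi ZPi; apply: noP; exists i.
Qed.

Lemma relation_gradient (w : 'I_3 -> Q) (P : {mpoly R[3]}) : P != 0 ->
  Z (P \mPo mktuple w) -> exists i, P^`M(i) != 0.
Proof.
move=> P0 ZP; apply: contrapT => /forallNP dP; case/negP: P0.
have PC : P = (P@_0%MM)%:MP.
  by apply: mderiv_eq0_const => i; have /negP := dP i; rewrite negbK => /eqP.
have [[s Ss] _] := ng_irr ngS; have := ZP s Ss.
by rewrite PC comp_mpolyC mevalC => ->; rewrite mpolyC0.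
Qed.

(** The coordinates of [w] other than [l] are algebraically independent, so a relation between them
    and any [q] involves [q]. A derivation that kills [w] therefore kills every [q], in particular
    the coordinates of x. *)
Lemma immersive_hypersurface (w : 'I_3 -> Q) :
  irreducible_hypersurface (zclosure [set poly_map w s | s in S]) ->
  immersive w.
Proof.
move=> /(hypersurface_free_variable (ng_irr ngS)) [l free] tau tt wt.
suff Zq q : Z (tder f tau q).
  move=> i; have : Z (sig * tau i).
    have := Zq (base 'X_i); rewrite tder_base.
    suff -> : \sum_k base ('X_i : {mpoly R[3]})^`M(k) * tau k = tau i by [].
    rewrite (bigD1 i) //= big1 => [|k /negbTE ki]; rewrite mderivXU.
      by rewrite eqxx rmorph1 mul1r addr0.
    by rewrite eq_sym ki rmorph0 mul0r.
  case/(Z_prime ngS) => // sig0; have [[s Ss] _] := ng_irr ngS.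
  by have := ng_slope ngS Ss; rewrite sig0 ?eqxx.
pose w' i := if i == l then q else w i.
have [P [P0 ZP minP]] := minimal_relation w'.
have ww' j : j != l -> w' j = w j by rewrite /w' => /negbTE ->.
have : Z ((P^`M(l) \mPo mktuple w') * tder f tau q).
  move=> s Ss; have := tder_vanishing ngS tt ZP Ss.
  rewrite /tder vfield_comp (bigD1 l) //= {2}/w' eqxx mevalD => <-.
  rewrite [X in _ = _ + X](_ : _ = 0) ?addr0 // meval_sum big1 // => j jl.
  by rewrite mevalM (ww' j jl) wt // mulr0.
case/(Z_prime ngS) => //.
have [Pl|/minP nZ] := eqVneq P^`M(l) 0; move=> // _.
case/eqP: P0; apply: (free _ Pl).
by rewrite -(comp_mderiv_eq0 Pl ww').
Qed.

Lemma tder_lin (a b : Q) tau tau' q :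
  tder f (fun j => a * tau j + b * tau' j) q =
  a * tder f tau q + b * tder f tau' q.
Proof.
rewrite /tder /vfield !mulr_sumr -big_split /=; apply: eq_bigr => i _.
rewrite /tfield; case: (split i) => j; first by ring.
have shE k : dgrad f (fun j => a * tau j + b * tau' j) k =
    a * dgrad f tau k + b * dgrad f tau' k.
  rewrite /dgrad !mulr_sumr -big_split /=; apply: eq_bigr => e _.
  by ring.
have -> : \sum_k normal k * dgrad f (fun j => a * tau j + b * tau' j) k =
   a * (\sum_k normal k * dgrad f tau k) + b * (\sum_k normal k * dgrad f tau'
     k).
  rewrite !mulr_sumr -big_split /=; apply: eq_bigr => e _.
  by rewrite shE; ring.
by rewrite shE; ring.
Qed.

Lemma tangent_lin (a b : Q) tau tau' : tangent tau -> tangent tau' ->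
  tangent (fun j => a * tau j + b * tau' j).
Proof.
move=> t t' s Ss.
have -> : \sum_k base f^`M(k) * (a * tau k + b * tau' k) =
  a * (\sum_k base f^`M(k) * tau k) + b * (\sum_k base f^`M(k) * tau' k).
  by rewrite !mulr_sumr -big_split /=; apply: eq_bigr => e _; ring.
by rewrite mevalD !mevalM (t s Ss) (t' s Ss) !mulr0 addr0.
Qed.

Lemma regular_coordinate : exists l, ~ Z (base f^`M(l)).
Proof.
apply: contrapT => /forallNP fl; have [[s Ss] _] := ng_irr ngS.
have := ng_slope ngS Ss; rewrite /slope meval_sum big1 ?eqxx// => i _.
have /contrapT := fl i; rewrite mevalM => -> //.
by rewrite mulr0.
Qed.

(** Where the partial derivative of [f] with index [l] is nonzero, the two fields with [k] different
    from [l] form a basis of the tangent plane. *)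
Definition frame (l k : 'I_3) (j : 'I_3) : Q :=
  base f^`M(l) * (j == k)%:R - base f^`M(k) * (j == l)%:R.

Lemma tangent_frame l k : tangent (frame l k).
Proof.
move=> s Ss; have pick (F : 'I_3 -> Q) i : \sum_j F j * (j == i)%:R = F i.
  rewrite (bigD1 i) //= big1 ?eqxx ?mulr1 ?addr0 // => j /negbTE ->.
  by rewrite mulr0.
rewrite (_ : \sum_k0 _ = 0) ?meval0 // /frame.
under eq_bigr do rewrite mulrBr !mulrA.
rewrite sumrB (pick (fun j => base f^`M(j) * base f^`M(l))).
by rewrite (pick (fun j => base f^`M(j) * base f^`M(k))) mulrC subrr.
Qed.

(* The tangent vectors of an immersed surface span a plane, so that its normal
   direction is unique. *)
Lemma normal_unique (w u v : 'I_3 -> Q) : immersive w ->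
  (forall tau, tangent tau -> Z (\sum_i u i * tder f tau (w i))) ->
  (forall tau, tangent tau -> Z (\sum_i v i * tder f tau (w i))) ->
  forall i j, Z (u i * v j - u j * v i).
Proof.
move=> imm uw vw.
suff Zc : forall r, Z (cross u v r).
  have := (Zc 0, Zc 1, Zc 2); rewrite /cross !ord3_add => -[[Z0 Z1] Z2].
  have neg p q : Z (p - q) -> Z (q - p).
    by move=> pq s Ss; rewrite -opprB mevalN pq // oppr0.
  have Zd p : Z (p - p) by rewrite subrr => s _; rewrite meval0.
  by apply: ord3_ind; apply: ord3_ind; first [exact: Zd | exact | exact: neg].
move=> r; apply: contrapT => Zr.
(* Every derivative of [w] is orthogonal to [u] and [v], hence parallel to their cross product. *)
have par tau p q : tangent tau ->
    Z (tder f tau (w p) * cross u v q - tder f tau (w q) * cross u v p).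
  move=> tt s Ss.
  have ev (a : 'I_3 -> Q) : tangent tau -> Z (\sum_i a i * tder f tau (w i)) ->
      \sum_i (a i).@[s 0] * (tder f tau (w i)).@[s 0] = 0.
    move=> _ /(_ s Ss); rewrite meval_sum => E; rewrite -[RHS]E.
    by apply: eq_bigr => i _; rewrite mevalM.
  have := cross_orthogonal (ev u tt (uw _ tt)) (ev v tt (vw _ tt)) p q.
  by rewrite /cross !(mevalB, mevalM) => ->; rewrite subrr.
have [l fl] := regular_coordinate.
have lk : (l + 1 == l) = false by move: l {fl}; apply: ord3_ind.
have lm : (l + 2 == l) = false by move: l {fl lk}; apply: ord3_ind.
have km : (l + 1 == l + 2) = false by move: l {fl lk lm}; apply: ord3_ind.
have [tk [tkt tk1]] : exists tau, tangent tau /\ tau (l + 1) = base f^`M(l).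
  exists (frame l (l + 1)); split; first exact: tangent_frame.
  by rewrite /frame eqxx lk mulr1 mulr0 subr0.
have [tm [tmt tm1 tm2]] : exists tau,
    [/\ tangent tau, tau (l + 1) = 0 & tau (l + 2) = base f^`M(l)].
  exists (frame l (l + 2)); split; first exact: tangent_frame.
    by rewrite /frame lk km !mulr0 subr0.
  by rewrite /frame eqxx lm mulr1 mulr0 subr0.
(* By parallelism, coordinate [r] alone detects whether a derivative of [w] vanishes. *)
have killed tau : tangent tau -> Z (tder f tau (w r)) -> forall i, Z (tau i).
  move=> tt tr; apply: imm => // i.
  have : Z (tder f tau (w i) * cross u v r).
    move=> s Ss; have := par tau i r tt s Ss.
    by rewrite mevalB [X in _ - X]mevalM tr // mul0r subr0.
  by case/(Z_prime ngS) => [//|Zcr]; case: (Zr Zcr).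
(* The combination of [tk] and [tm] below kills [w r], so it vanishes; its coordinate [l + 1] gives
   [a = 0], and then [tm] would vanish too. *)
have [a aE] : exists a, a = tder f tm (w r) by eexists.
have [b bE] : exists b, b = tder f tk (w r) by eexists.
have Ztau : forall i, Z (a * tk i + - b * tm i).
  apply: killed; first exact: tangent_lin.
  rewrite tder_lin -aE -bE mulNr [a * b]mulrC subrr => s _.
  by rewrite meval0.
have Za : Z a.
  have : Z (a * base f^`M(l)).
    move=> s Ss; have := Ztau (l + 1) s Ss.
    by rewrite tk1 tm1 mulr0 addr0.
  by case/(Z_prime ngS) => [//|Zl]; case: (fl Zl).
rewrite aE in Za; apply: fl; have := killed tm tmt Za (l + 2).
by rewrite tm2.
Qed.

End Rank.

(** * Offsets and conchoids *)

Section RationalMaps.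
Context {R : realType}.
Implicit Types (p : {mpoly R[3]}) (x : 'rV[R]_3).

(* x |-> foot point of the plane through x with normal vector grad p x. *)
Definition pedal_map p : ratmap R 3 3 := RatMap
  (fun j => (\sum_i p^`M(i) * 'X_i) * p^`M(j)) (\sum_i p^`M(i) ^+ 2).

(* The midpoint of O and of the contact point of a plane lies on the normal of
   the pedal surface at the foot point of that plane. *)
Definition contact_map p : ratmap R 3 3 := RatMap
  (fun j => 2%:MP * 'X_j * (\sum_i 'X_i * p^`M(i)) - (\sum_i 'X_i ^+ 2) *
    p^`M(j))
  (\sum_i 'X_i * p^`M(i)).

Lemma rden_pedal_map p x :
  (rden (pedal_map p)).@[x 0] = \sum_i p^`M(i).@[x 0] ^+ 2.
Proof. by rewrite meval_sum; apply: eq_bigr => i _; rewrite rmorphXn. Qed.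

Lemma rden_contact_map p x :
  (rden (contact_map p)).@[x 0] = \sum_i x 0 i * p^`M(i).@[x 0].
Proof.
by rewrite meval_sum; apply: eq_bigr => i _; rewrite mevalM mevalXU.
Qed.

Lemma dot_gt0 (m : 'rV[R]_3) : m != 0 -> 0 < dot m m.
Proof.
move=> m0; rewrite lt_neqAle sumr_ge0 ?andbT => [|i _]; last exact: sqr_ge0.
apply: contra_neq m0 => /esym/eqP; rewrite psumr_eq0 => [/allP m0|i _];
  last exact: sqr_ge0.
apply/rowP => i; rewrite mxE; have := m0 i (mem_index_enum _).
by rewrite mulf_eq0 orbb => /eqP.
Qed.

Lemma pedal_mapE p x (m : 'rV[R]_3) (t : R) : t != 0 -> m != 0 ->
    (forall i, p^`M(i).@[x 0] = t * m 0 i) ->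
  rdom (pedal_map p) x /\ reval (pedal_map p) x = foot_point (m, dot m x).
Proof.
move=> t0 /dot_gt0/gt_eqF/negbT mm0 grad.
have denE : (rden (pedal_map p)).@[x 0] = t ^+ 2 * dot m m.
  rewrite rden_pedal_map mulr_sumr; apply: eq_bigr => i _.
  by rewrite grad; ring.
split; first by rewrite /rdom /= -/(rden (pedal_map p)) denE mulf_neq0
  ?expf_neq0.
apply/rowP => j; rewrite /foot_point mxE denE !mxE /= mevalM.
have -> : (\sum_i p^`M(i) * 'X_i).@[x 0] = t * dot m x.
  rewrite meval_sum mulr_sumr; apply: eq_bigr => i _.
  by rewrite mevalM mevalXU grad mulrA.
by rewrite grad; field; rewrite t0 mm0.
Qed.

(** Write 2 x - y as a multiple of [grad p] at x; its product with x is 2 r - r = r, which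
    determines the factor and hence y. *)
Lemma contact_mapE p x (r : R) (y : 'I_3 -> R) :
  (forall i j, (2 * x 0 i - y i) * p^`M(j).@[x 0] =
               (2 * x 0 j - y j) * p^`M(i).@[x 0]) ->
  \sum_i x 0 i ^+ 2 = r -> \sum_i x 0 i * y i = r ->
  rdom (contact_map p) x -> forall j, reval (contact_map p) x 0 j = y j.
Proof.
move=> par xx xy; rewrite /rdom /= => den j; rewrite mxE /= mevalB !mevalM.
have denE := rden_contact_map p x; rewrite /= in denE den.
rewrite mevalC mevalXU [(\sum_i 'X_i ^+ 2).@[_]](_ : _ = r); last first.
  by rewrite meval_sum -xx; apply: eq_bigr => i _; rewrite rmorphXn /= mevalXU.
have : (2 * x 0 j - y j) * (\sum_i 'X_i * p^`M(i)).@[x 0] = r * p^`M(j).@[x 0].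
  rewrite denE mulr_sumr; under eq_bigr => i _ do rewrite mulrCA par mulrA.
  rewrite -mulr_suml; congr (_ * _).
  rewrite (eq_bigr (fun i => 2 * x 0 i ^+ 2 - x 0 i * y i)); last first.
    by move=> i _; ring.
  by rewrite sumrB -mulr_sumr xx xy; ring.
move=> <-; apply: (mulIf den); rewrite divfK //; ring.
Qed.

End RationalMaps.

(** * Tangent vectors of the offset and of the conchoid *)

Section OffsetConchoid.
Context {R : realType}.
Local Notation Q := {mpoly R[3 + 3]}.
Context (f : {mpoly R[3]}) (S : set 'rV[R]_(3 + 3)) (ngS : normal_graph f S).
Context (d : R).
Local Notation Z := (vanishing_ideal S).
Local Notation sig := (slope f).

Definition offset_point (c : R) (i : 'I_3) : Q := base 'X_i + c%:MP * normal i.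

(** On the graph this equals e + c, where e = n . x is the support function of F; thus
    [conchoid_point 0] is the foot point of the tangent plane. *)
Definition support (c : R) : Q := \sum_i normal i * offset_point c i.

Definition conchoid_point (c : R) (i : 'I_3) : Q := support c * normal i.

Section Values.
Variables (tau : 'I_3 -> Q) (s : 'rV[R]_(3 + 3)).
Hypotheses (tt : tangent f S tau) (Ss : S s).
Local Notation nu i := (normal i).@[s 0].
Local Notation T := (tder f tau).

Lemma tder_normal_orthogonal : \sum_i nu i * (T (normal i)).@[s 0] = 0.
Proof.
under eq_bigr => i _ do rewrite tder_normal mevalB mevalM mulrBr.
rewrite sumrB; apply/eqP; rewrite subr_eq0; apply/eqP.
rewrite (eq_bigr (fun i => (\sum_k normal k * dgrad f tau k).@[s 0] * nu i ^+ 2)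
  (P := predT) (r := index_enum 'I_3) (F1 := fun i => nu i * (_ * nu i)));
    last first.
  by move=> i _; ring.
rewrite -mulr_sumr (ng_unit ngS) // mulr1 meval_sum.
by apply: eq_bigr => i _; rewrite mevalM.
Qed.

Lemma tder_offset_point c i : (T (offset_point c i)).@[s 0] =
  sig.@[s 0] * (tau i).@[s 0] + c * (T (normal i)).@[s 0].
Proof.
rewrite /offset_point /tder vfieldD vfieldM vfieldC -!/(tder f tau _).
rewrite mul0r add0r tder_base mevalD !mevalM mevalC; congr (_ * _ + _).
rewrite meval_sum (bigD1 i) //= big1 => [|k /negbTE ki]; rewrite mderivXU.
  by rewrite eqxx rmorph1 mul1r addr0.
by rewrite eq_sym ki rmorph0 mul0r meval0.
Qed.

(** The derivative of y combines those of x and n, both orthogonal to n: F and its offsets share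
    their normals. *)
Lemma tder_offset_orthogonal c :
  \sum_i nu i * (T (offset_point c i)).@[s 0] = 0.
Proof.
under eq_bigr => i _ do rewrite tder_offset_point mulrDr mulrCA [X in _ +
  X]mulrCA.
rewrite big_split /= -!mulr_sumr tder_normal_orthogonal mulr0 addr0 mulr_sumr.
rewrite -[RHS](tt Ss) [RHS]meval_sum; apply: eq_bigr => i _.
by rewrite mevalM (ng_grad ngS) // mulrA.
Qed.

Lemma tder_support c : (T (support c)).@[s 0] =
  \sum_i (offset_point c i).@[s 0] * (T (normal i)).@[s 0].
Proof.
rewrite /support /tder vfield_sum meval_sum.
under eq_bigr => i _ do rewrite vfieldM -!/(tder f tau _) mevalD !mevalM mulrC.
by rewrite big_split /= tder_offset_orthogonal addr0.
Qed.

Lemma tder_support0 c : (T (support c)).@[s 0] = (T (support 0)).@[s 0].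
Proof.
rewrite !tder_support /offset_point.
under eq_bigr => i _ do rewrite mevalD mevalM mevalC mulrDl -mulrA.
rewrite big_split /= -mulr_sumr tder_normal_orthogonal mulr0 addr0.
by apply: eq_bigr => i _; rewrite mevalD mevalM mevalC mul0r addr0.
Qed.

Lemma tder_conchoid_point c i : (T (conchoid_point c i)).@[s 0] =
  (T (support c)).@[s 0] * nu i + (support c).@[s 0] * (T (normal i)).@[s 0].
Proof. by rewrite /tder vfieldM mevalD !mevalM. Qed.

Lemma supportE c : \sum_i nu i * (offset_point c i).@[s 0] = (support c).@[s 0].
Proof. by rewrite meval_sum; apply: eq_bigr => i _; rewrite mevalM. Qed.

End Values.

Hypothesis foot_surface : irreducible_hypersurface
  (zclosure [set poly_map (conchoid_point 0) s | s in S]).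
Hypothesis offset_surface : irreducible_hypersurface
  (zclosure [set poly_map (offset_point d) s | s in S]).
Local Notation y := (offset_point d).
Local Notation z := (conchoid_point d).
Local Notation rho := (support d).

(** A derivation that kills n and the support kills the tangent planes, hence their foot points, and
    these form a surface. *)
Lemma immersive_planes tau : tangent f S tau ->
  (forall i, Z (tder f tau (normal i))) -> Z (tder f tau rho) ->
  forall i, Z (tau i).
Proof.
move=> tt Tn Te; apply: (immersive_hypersurface ngS foot_surface tt) => i s Ss.
rewrite tder_conchoid_point -(tder_support0 tt Ss d) Te // Tn //.
by rewrite mul0r mulr0 addr0.
Qed.

(** Otherwise all tangent planes of the offset pass through O. Then n alone is immersive, and n and
    y are both orthogonal to its derivatives, hence parallel; n . y = 0 forces y = 0, so the offset
    would be a single point. *)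
Lemma support_nonzero : ~ Z rho.
Proof.
move=> Zr.
have imm : immersive f S normal.
  move=> tau tt Tn; apply: immersive_planes => //.
  exact: (tder_vanishing ngS tt Zr).
have par : forall i j, Z (normal i * y j - normal j * y i).
  apply: (normal_unique ngS imm) => tau tt s Ss.
    rewrite meval_sum -[RHS](tder_normal_orthogonal tau Ss).
    by apply: eq_bigr => i _; rewrite mevalM.
  rewrite meval_sum -[RHS](tder_vanishing ngS tt Zr Ss) (tder_support tt Ss).
  by apply: eq_bigr => i _; rewrite mevalM.
have Zy j : Z (y j).
  move=> s Ss; rewrite -[LHS]mul1r -(ng_unit ngS Ss) mulr_suml.
  transitivity (\sum_i (normal j).@[s 0] * ((normal i).@[s 0] * (y i).@[s 0])).
    apply: eq_bigr => i _; have := par i j s Ss.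
    by rewrite mevalB !mevalM => /eqP; rewrite subr_eq0 => /eqP E;
      rewrite expr2 -mulrA E; ring.
  by rewrite -mulr_sumr supportE Zr // mulr0.
have [i free] := hypersurface_free_variable (ng_irr ngS) offset_surface.
have ii : (i + 1 == i) = false by move: i {free}; apply: ord3_ind.
have /eqP : ('X_(i + 1) : {mpoly R[3]}) = 0.
  apply: free; first by rewrite mderivXU ii.
  by rewrite comp_mpolyXU -tnth_nth tnth_mktuple.
by rewrite -msize_poly_eq0 msizeX.
Qed.

(** The product n . Tz is the derivative of [rho]; since [rho] is nonzero, the rest of Tz gives Tn,
    and [immersive_planes] applies. *)
Lemma immersive_conchoid : immersive f S z.
Proof.
move=> tau tt Tz.
have Zr : Z (tder f tau rho).
  move=> s Ss; rewrite -[LHS]mulr1 -(ng_unit ngS Ss) mulr_sumr.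
  rewrite (eq_bigr (fun i => (normal i).@[s 0] * (tder f tau (z i)).@[s 0]
    - rho.@[s 0] * ((normal i).@[s 0] * (tder f tau (normal i)).@[s 0]))).
    rewrite sumrB -mulr_sumr (tder_normal_orthogonal tau Ss) mulr0 subr0.
    by rewrite big1 // => i _; rewrite Tz // mulr0.
  by move=> i _; rewrite tder_conchoid_point; ring.
apply: immersive_planes => // i.
have : Z (rho * tder f tau (normal i)).
  move=> s Ss; have := Tz i s Ss.
  by rewrite tder_conchoid_point Zr // mul0r add0r mevalM.
by case/(Z_prime ngS) => // /support_nonzero.
Qed.

Lemma birational_offset_conchoid : birational
  (zclosure [set poly_map y s | s in S]) (zclosure [set poly_map z s | s in S]).
Proof.
have [a [a0 Za amin]] := minimal_relation ngS y.
have [b [b0 Zb bmin]] := minimal_relation ngS z.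
have [ia /amin aia] := relation_gradient ngS a0 Za.
have [ib /bmin bib] := relation_gradient ngS b0 Zb.
have grad_tangent w P tau : Z (P \mPo mktuple w) -> tangent f S tau ->
    Z (\sum_i (P^`M(i) \mPo mktuple w) * tder f tau (w i)).
  by move=> ZP tt; have := tder_vanishing ngS tt ZP; rewrite /tder vfield_comp.
have nua : forall i j, Z (normal i * (a^`M(j) \mPo mktuple y) -
                  normal j * (a^`M(i) \mPo mktuple y)).
  apply: (normal_unique ngS (immersive_hypersurface ngS offset_surface)).
    move=> tau tt s Ss;
      rewrite meval_sum -[RHS](tder_offset_orthogonal tt Ss d).
    by apply: eq_bigr => k _; rewrite mevalM.
  by move=> tau; apply: grad_tangent.
have mub : forall i j, Z ((2%:MP * z i - y i) * (b^`M(j) \mPo mktuple z) -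
                  (2%:MP * z j - y j) * (b^`M(i) \mPo mktuple z)).
  apply: (normal_unique ngS immersive_conchoid); last first.
    by move=> tau; apply: grad_tangent.
  move=> tau tt s Ss; rewrite meval_sum.
  (* With z = rho n, n . y = rho and y . Tn = T rho, the four sums give 2 rho T rho + 0 - rho T rho
     - rho T rho = 0. *)
  rewrite (eq_bigr (fun k =>
    2 * (rho.@[s 0] * (tder f tau rho).@[s 0]) * (normal k).@[s 0] ^+ 2
    + 2 * rho.@[s 0] ^+ 2 * ((normal k).@[s 0] * (tder f tau (normal k)).@[s 0])
    - (tder f tau rho).@[s 0] * ((normal k).@[s 0] * (y k).@[s 0])
    - rho.@[s 0] * ((y k).@[s 0] * (tder f tau (normal k)).@[s 0])));
        last first.
    move=> k _; rewrite mevalM mevalB mevalM mevalC tder_conchoid_point.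
    by rewrite [(z k).@[_]]mevalM; ring.
  rewrite !sumrB big_split /= -!mulr_sumr (ng_unit ngS Ss) supportE.
  rewrite (tder_normal_orthogonal tau Ss) -(tder_support tt Ss).
  by ring.
pose t := \sum_i normal i * (a^`M(i) \mPo mktuple y).
have gradE s i : S s -> a^`M(i).@[poly_map y s 0] = t.@[s 0] * (normal i).@[s
  0].
  move=> Ss; rewrite -meval_comp -[LHS]mul1r -(ng_unit ngS Ss) mulr_suml.
  rewrite [t.@[_]]meval_sum mulr_suml; apply: eq_bigr => j _;
    have := nua i j s Ss.
  rewrite mevalB !mevalM => /eqP; rewrite subr_eq0 => /eqP E.
  by rewrite expr2 -mulrA -E; ring.
have yE s i : poly_map y s 0 i = (y i).@[s 0] by rewrite mxE.
have zE s i : poly_map z s 0 i = rho.@[s 0] * (normal i).@[s 0].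
  by rewrite mxE mevalM.
have zz s : S s -> \sum_i poly_map z s 0 i ^+ 2 = rho.@[s 0] ^+ 2.
  move=> Ss; under eq_bigr do rewrite zE exprMn.
  by rewrite -mulr_sumr (ng_unit ngS Ss) mulr1.
have zy s : S s -> \sum_i poly_map z s 0 i * (y i).@[s 0] = rho.@[s 0] ^+ 2.
  move=> Ss; under eq_bigr do rewrite zE -mulrA.
  by rewrite -mulr_sumr supportE expr2.
have par s i j : S s ->
    (2 * poly_map z s 0 i - (y i).@[s 0]) * b^`M(j).@[poly_map z s 0] =
    (2 * poly_map z s 0 j - (y j).@[s 0]) * b^`M(i).@[poly_map z s 0].
  move=> Ss; have := mub i j s Ss;
    rewrite !(mevalB, mevalM, mevalC) !meval_comp.
  move=> /eqP; rewrite subr_eq0 => /eqP E.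
  by rewrite [poly_map z s 0 i]zE [poly_map z s 0 j]zE.
apply: (@birational_images _ _ _ _ S y z (pedal_map a) (contact_map b)).
- exact: ng_irr ngS.
(* The denominator is a sum of squares over the reals, so it vanishes only where every partial
   derivative of [a] does. *)
- move=> Zden; apply: aia => s Ss; have := Zden s Ss.
  rewrite !meval_comp rden_pedal_map => /eqP.
  rewrite psumr_eq0 => [|i _]; last exact: sqr_ge0.
  by move=> /allP/(_ ia); rewrite mem_index_enum sqrf_eq0 => /(_ isT)/eqP.
(* Since z . (2 z - y) is [rho ^+ 2] and [grad b] is parallel to 2 z - y, a vanishing denominator z
   . grad b would make [rho ^+ 2] times [grad b] vanish. *)
- move=> Zden; have : Z (rho ^+ 2 * (b^`M(ib) \mPo mktuple z)).
    move=> s Ss; have := Zden s Ss; rewrite !meval_comp rden_contact_map => den.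
    rewrite mevalM rmorphXn /= meval_comp -(mulr0 (2 * poly_map z s 0 ib - (y
      ib).@[s 0])) -den.
    have -> : rho.@[s 0] ^+ 2 =
        \sum_i poly_map z s 0 i * (2 * poly_map z s 0 i - (y i).@[s 0]).
      rewrite (eq_bigr (fun i => 2 * poly_map z s 0 i ^+ 2
        - poly_map z s 0 i * (y i).@[s 0])) => [|i _]; last by ring.
      by rewrite sumrB -mulr_sumr (zz s Ss) (zy s Ss); ring.
    rewrite mulr_suml mulr_sumr; apply: eq_bigr => i _.
    by rewrite -mulrA (par s i ib Ss); ring.
  by rewrite expr2 -mulrA; case/(Z_prime ngS) => [/support_nonzero//|];
    case/(Z_prime ngS) => [/support_nonzero//|/bib].
- move=> s Ss; rewrite /rdom /= -/(rden (pedal_map a)) rden_pedal_map => den.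
  pose m : 'rV[R]_3 := \row_i (normal i).@[s 0].
  have mm : dot m m = 1.
    by rewrite -(ng_unit ngS Ss); apply: eq_bigr => i _; rewrite !mxE -expr2.
  have m0 : m != 0.
    apply/eqP => m0; move/eqP: mm; rewrite m0 /dot big1 => [|i _].
      by rewrite eq_sym oner_eq0.
    by rewrite mxE mul0r.
  have t0 : t.@[s 0] != 0.
    apply/eqP => t0; move/eqP: den; apply; apply: big1 => i _.
    by rewrite (gradE s i Ss) t0 mul0r expr0n.
  have [_ ->] : rdom (pedal_map a) (poly_map y s) /\
      reval (pedal_map a) (poly_map y s) = foot_point (m, dot m (poly_map y s)).
    by apply: (pedal_mapE t0 m0) => i; rewrite mxE; exact: gradE.
  rewrite /foot_point /= mm divr1; apply/rowP => j; rewrite zE !mxE -supportE.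
  by congr (_ * _); apply: eq_bigr => i _; rewrite !mxE.
- move=> s Ss den; apply/rowP => j; rewrite yE.
  apply: (contact_mapE (r := rho.@[s 0] ^+ 2) (y := fun i => (y i).@[s 0])).
  + by move=> i k; exact: par.
  + exact: zz.
  + exact: zy.
  + exact: den.
Qed.

End OffsetConchoid.

(** * The graph of a unit normal field *)

Section Main.
Context {R : realType} (F U : set 'rV[R]_3) (n : 'rV[R]_3 -> 'rV[R]_3).
Context (f : {mpoly R[3]}).
Hypothesis idealF : vanishing_ideal F = [set q | exists r, q = r * f].
Hypothesis fieldn : unit_normal_field F U n.
Local Notation S := [set row_mx x (n x) | x in U].
Local Notation e := (fun x => dot x (n x)).

Lemma meval_base p (x v : 'rV[R]_3) : (base p).@[row_mx x v 0] = p.@[x 0].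
Proof.
rewrite /base comp_mpoly_meval; apply: meval_eq => i.
by rewrite tnth_mktuple mevalXU row_mxEl.
Qed.

Lemma meval_normal i (x v : 'rV[R]_3) : (normal i).@[row_mx x v 0] = v 0 i.
Proof. by rewrite mevalXU row_mxEr. Qed.

Lemma dotC (u v : 'rV[R]_3) : dot u v = dot v u.
Proof. by apply: eq_bigr => i _; rewrite mulrC. Qed.

Lemma F_vanishing x : F x -> f.@[x 0] = 0.
Proof.
have : vanishing_ideal F f by rewrite idealF; exists 1; rewrite mul1r.
exact.
Qed.

Lemma normal_at_grad x m : normal_at F x m ->
  exists2 t, t != 0 & forall i, m 0 i = t * f^`M(i).@[x 0].
Proof.
case=> Fx m0 [p]; rewrite idealF => -[r ->] mE.
have gE i : m 0 i = r.@[x 0] * f^`M(i).@[x 0].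
  by rewrite mE mxE mderivM mevalD !mevalM F_vanishing // mulr0 add0r.
exists r.@[x 0] => //; apply: contra_neq m0 => r0.
by apply/rowP => i; rewrite gE r0 mul0r mxE.
Qed.

Lemma unit_normal x : U x -> \sum_i n x 0 i ^+ 2 = 1.
Proof. by case: fieldn => _ h _ /h [_ <-]. Qed.

Lemma unit_normal_grad x : U x ->
  exists2 t, t != 0 & forall i, f^`M(i).@[x 0] = t * n x 0 i.
Proof.
case: fieldn => _ h _ /h [/normal_at_grad [t t0 tE] _].
by exists t^-1; rewrite ?invr_eq0 // => i; rewrite tE mulKf.
Qed.

Lemma normal_graph_field : normal_graph f S.
Proof.
case: (fieldn) => dU h irrS.
have slopeE x t : U x -> (forall i, f^`M(i).@[x 0] = t * n x 0 i) ->
    (slope f).@[row_mx x (n x) 0] = t.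
  move=> Ux tE; rewrite meval_sum -[RHS]mulr1 -(unit_normal Ux) mulr_sumr.
  by apply: eq_bigr => i _; rewrite mevalM meval_normal meval_base tE; ring.
split=> // [p|_ [x Ux <-]|_ i [x Ux <-]|_ [x Ux <-]].
- split=> [Zp|[r ->] _ [x Ux <-]].
    have : vanishing_ideal F p.
      apply: (vanishing_ideal_zdense dU) => x Ux.
      by rewrite -(meval_base p x (n x)); apply: Zp; exists x.
    by rewrite idealF.
  by rewrite meval_base mevalM F_vanishing ?mulr0 //; case: dU => + _; apply.
- by rewrite -(unit_normal Ux); apply: eq_bigr => i _; rewrite meval_normal.
- have [t _ tE] := unit_normal_grad Ux.
  by rewrite (slopeE _ _ Ux tE) meval_base meval_normal.
- have [t t0 tE] := unit_normal_grad Ux.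
  by rewrite (slopeE _ _ Ux tE).
Qed.

Lemma zclosure_subset k (A B : set 'rV[R]_k) :
  A `<=` zclosure B -> zclosure A `<=` zclosure B.
Proof. by move=> AB x Ax p pB; apply: Ax => y /AB; apply. Qed.

(** The left side uses the tangent planes at all regular points of [F], the right side only those
    over [U]. The foot point is given by the rational map [pedal_map f], which sends the closure of
    [U] into the closure of its image. *)
Lemma foot_point_surfaceE : foot_point_surface F = zclosure [set e x *: n x | x
  in U].
Proof.
case: (fieldn) => dU h _; apply/seteqP; split; apply: zclosure_subset.
  move=> _ [[m _] [x [/= nx ->]] <-]; have [Fx m0 _] := nx.
  have [t t0 mE] := normal_at_grad nx.
  have [||i|fx <-] := @pedal_mapE _ f x m t^-1; rewrite ?invr_eq0 //.
    by rewrite mE mulKf.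
  apply: rational_map_zclosure (dU.2 x Fx) fx => z Uz _.
  exists z => //; have [s s0 sE] := unit_normal_grad Uz.
  have [[_ n0 _] nn] := h z Uz; have [_ ->] := pedal_mapE s0 n0 sE.
  by rewrite /foot_point /= nn divr1 dotC.
move=> _ [x Ux <-]; apply: sub_zclosure; have [nx nn] := h x Ux.
exists (n x, dot (n x) x); first by exists x.
by rewrite /foot_point /= nn divr1 dotC.
Qed.

Lemma offset_pointE c : [set poly_map (offset_point c) s | s in S] =
  [set x + c *: n x | x in U].
Proof.
have E x : U x -> poly_map (offset_point c) (row_mx x (n x)) = x + c *: n x.
  move=> _; apply/rowP => i.
  by rewrite !mxE mevalD mevalM mevalC meval_base meval_normal mevalXU.
by apply/seteqP; split=> [_ [_ [x Ux <-] <-]|_ [x Ux <-]];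
  [exists x; rewrite ?E|exists (row_mx x (n x)); [exists x|exact: E]].
Qed.

Lemma conchoid_pointE c : [set poly_map (conchoid_point c) s | s in S] =
  [set (e x + c) *: n x | x in U].
Proof.
have E x : U x -> poly_map (conchoid_point c) (row_mx x (n x)) = (e x + c) *: n
  x.
  move=> Ux; apply/rowP => i; rewrite !mxE mevalM meval_normal; congr (_ * _).
  rewrite -[c in RHS]mulr1 -(unit_normal Ux) mulr_sumr -big_split /= meval_sum.
  apply: eq_bigr => j _.
  rewrite mevalM meval_normal /offset_point mevalD mevalM mevalC meval_base.
  by rewrite meval_normal mevalXU; ring.
by apply/seteqP; split=> [_ [_ [x Ux <-] <-]|_ [x Ux <-]];
  [exists x; rewrite ?E|exists (row_mx x (n x)); [exists x|exact: E]].
Qed.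

End Main.

Theorem proposition5 (R : realType) (F U : set 'rV[R]_3)
    (n : 'rV[R]_3 -> 'rV[R]_3) (d : R) :
  let e := fun x : 'rV[R]_3 => dot x (n x) in
  let G := foot_point_surface F in
  irreducible_hypersurface F ->
  unit_normal_field F U n ->
  irreducible_hypersurface G ->
  irreducible_hypersurface (offset U n d) ->
  polar_representation G U e n /\
  birational (offset U n d) (conchoid U e n d).
Proof.
move=> e G [f [_ _ idealF]] fieldn hypG hypA.
have GE := foot_point_surfaceE idealF fieldn.
split; first by split=> // x; case: fieldn => _ h _ /h [].
have ngS := normal_graph_field idealF fieldn.
move: hypA; rewrite /offset /conchoid -offset_pointE -(conchoid_pointE fieldn).
apply: (birational_offset_conchoid ngS).
(* [G] is the conchoid at distance 0. *)
rewrite (conchoid_pointE fieldn); move: hypG; rewrite /G GE.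
by under eq_fun do rewrite -[X in X *: _]addr0.
Qed.
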